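(* Let $(\mathcal{T},\otimes,\mathbb{1})$ be a tensor triangulated category (with countable coproducts) that satisfies additivity of traces, and let $R:=\mathcal{T}_*(\mathbb{1},\mathbb{1})$, a graded-commutative graded ring. Let $F\in\mathcal{T}(A,A)$ be an endomorphism of some object $A$ of $\mathcal{T}$. Assume that $A$ belongs to the localising subcategory of $\mathcal{T}$ generated by $\mathbb{1}$. If the graded $R$-module $M(A):=\mathcal{T}_*(\mathbb{1},A)$ has a finite projective resolution, then $A$ is dualisable in $\mathcal{T}$ and the trace of $F$ is equal to the Hattori–Stallings trace of the induced module endomorphism $\mathcal{T}_*(\mathbb{1},F)$ of $M(A)$.
   Context: $\mathcal{T}_*(A,B)=\bigoplus_{n\in\mathbb{Z}}\mathcal{T}_n(A,B)$ denotes the graded morphism group, where $\mathcal{T}_n(A,B)$ are the morphisms of degree $n$ defined using the shift; $\mathcal{T}_*(\mathbb{1},A)$ is a graded $R$-module. The tensor product is assumed compatible with the triangulated structure in the usual way (so that $R$ is graded-commutative). The localising subcategory generated by $\mathbb{1}$ is the smallest triangulated subcategory containing $\mathbb{1}$ and closed under (countable) coproducts. Trace. $A$ is dualisable if there are $A^*$, $\eta\colon\mathbb{1}\to A\otimes A^*$, $\varepsilon\colon A^*\otimes A\to\mathbb{1}$ satisfying the zigzag equations; $\operatorname{tr}(F)\in\mathcal{T}(\mathbb{1},\mathbb{1})$ is the composite $\mathbb{1}\xrightarrow{\eta}A\otimes A^*\cong A^*\otimes A\xrightarrow{\mathrm{id}\otimes F}A^*\otimes A\xrightarrow{\varepsilon}\mathbb{1}$.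 Additivity of traces means: whenever $A\to B\to C\to A[1]$ is an exact triangle in $\mathcal{T}$ with $A$ and $B$ dualisable and $f_A\colon A\to A$, $f_B\colon B\to B$ commute with the map $A\to B$, then $C$ is dualisable and there is $f_C\colon C\to C$ such that $(f_A,f_B,f_C)$ is a morphism of triangles (with $f_A[1]$ on $A[1]$) and $\operatorname{tr}(f_C)-\operatorname{tr}(f_B)+\operatorname{tr}(f_A)=0$. Hattori–Stallings trace. Let $R[n]$ be $R$ with $R[n]_i=R_{n+i}$. For an endomorphism $\Psi$ of a finitely generated free graded module $P\cong\bigoplus_{i=1}^rR[n_i]$, with matrix $(\psi_{ij})$, $\psi_{ij}\colon R[n_j]\to R[n_i]$ given by right multiplication by elements of $R$, put $\operatorname{tr}\Psi=\sum_i(-1)^{n_i}\psi_{ii}\in R$; this is independent of the isomorphism. For $P$ finitely generated projective, choose $Q$ with $P\oplus Q$ finitely generated free and put $\operatorname{tr}\Psi=\operatorname{tr}(\Psi\oplus0_Q)$. A finite projective resolution of a graded $R$-module $M$ is a resolution $0\to P_\ell\xrightarrow{d_\ell}P_{\ell-1}\to\cdots\xrightarrow{d_1}P_0\xrightarrow{d_0}M$ of finite length by finitely generated projective graded $R$-modules, where the boundary maps $d_j$, $j\ge1$, have degree one and the augmentation $d_0$ has degree zero. For a module endomorphism $g\colon M\to M$, lift $g$ to a chain map $(g_j\colon P_j\to P_j)_j$ and define $\operatorname{tr}(g):=\sum_{j=0}^\ell\operatorname{tr}(g_j)$. This does not depend on the choices. (Because the $d_j$ have degree one, the signs in the graded trace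 make this an alternating sum in the ungraded convention.) *)

(* Defs.v *)
From HB Require Import structures.
From mathcomp Require Import all_boot all_order all_algebra.

Set Implicit Arguments.
Unset Strict Implicit.
Unset Printing Implicit Defensive.

Import GRing.Theory.
Local Open Scope ring_scope.

Declare Scope tt_scope.
Delimit Scope tt_scope with tt.
Reserved Notation "g ∘ f" (at level 40, left associativity).
Reserved Notation "f ⊠ g" (at level 38, left associativity).

Record preadditive := Preadditive {
  obj :> Type;
  mor : obj -> obj -> zmodType;
  idm : forall X, mor X X;
  comp : forall X Y Z, mor Y Z -> mor X Y -> mor X Z;
  compA : forall X Y Z W (h : mor Z W) (g : mor Y Z) (f : mor X Y),
    comp h (comp g f) = comp (comp h g) f;
  comp1m : forall X Y (f : mor X Y), comp (idm Y) f = f;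
  compm1 : forall X Y (f : mor X Y), comp f (idm X) = f;
  compDl : forall X Y Z (g g' : mor Y Z) (f : mor X Y),
    comp (g + g') f = comp g f + comp g' f;
  compDr : forall X Y Z (g : mor Y Z) (f f' : mor X Y),
    comp g (f + f') = comp g f + comp g f' }.

Arguments idm {p} X.
Notation "g ∘ f" := (comp g f) : tt_scope.
Local Open Scope tt_scope.

Definition is_iso (C : preadditive) (X Y : C) (f : mor X Y) : Prop :=
  exists2 g : mor Y X, g ∘ f = idm X & f ∘ g = idm Y.

Definition is_zero_object (C : preadditive) (Z : C) : Prop :=
  forall X : C, (forall f : mor X Z, f = 0) /\ (forall f : mor Z X, f = 0).

Definition is_biproduct (C : preadditive) (X Y P : C)
    (i1 : mor X P) (i2 : mor Y P) (p1 : mor P X) (p2 : mor P Y) : Prop :=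
  [/\ p1 ∘ i1 = idm X, p2 ∘ i2 = idm Y, p2 ∘ i1 = 0, p1 ∘ i2 = 0
    & i1 ∘ p1 + i2 ∘ p2 = idm P].

Definition is_coproduct (C : preadditive) (X : nat -> C) (P : C)
    (i : forall n, mor (X n) P) : Prop :=
  forall (Y : C) (f : forall n, mor (X n) Y),
    exists! g : mor P Y, forall n, g ∘ i n = f n.

Definition has_countable_coproducts (C : preadditive) : Prop :=
  forall X : nat -> C,
    exists (P : C) (i : forall n, mor (X n) P), is_coproduct i.

(* The shift is an action of the group of integers by additive functors
   [sh n], written X |-> X[n], i.e. a strong monoidal functor from the discrete
   monoidal category on [int] to endofunctors; this is an autoequivalence
   X |-> X[1] together with a coherent choice of its powers.  The comparison
   X[m][n] ~ X[k] is indexed by a proof of m + n = k, so that associativity can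
   be stated without transporting along equalities of integers. *)
Record shiftCategory := ShiftCategory {
  shcat :> preadditive;
  zero_objectP : exists Z : shcat, is_zero_object Z;
  biproductP : forall X Y : shcat, exists (P : shcat) (i1 : mor X P)
    (i2 : mor Y P) (p1 : mor P X) (p2 : mor P Y), is_biproduct i1 i2 p1 p2;
  sh : int -> shcat -> shcat;
  shm : forall n (X Y : shcat), mor X Y -> mor (sh n X) (sh n Y);
  shm1 : forall n X, shm n (idm X) = idm (sh n X);
  shmM : forall n X Y Z (g : mor Y Z) (f : mor X Y),
    shm n (g ∘ f) = shm n g ∘ shm n f;
  shmD : forall n X Y (f f' : mor X Y), shm n (f + f') = shm n f + shm n f';
  sh0 : forall X, mor (sh 0 X) X;
  sh0V : forall X, mor X (sh 0 X);
  sh0K : forall X, sh0V X ∘ sh0 X = idm (sh 0 X);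
  sh0VK : forall X, sh0 X ∘ sh0V X = idm X;
  sh0_nat : forall X Y (f : mor X Y), sh0 Y ∘ shm 0 f = f ∘ sh0 X;
  shD : forall (m n k : int) (h : m + n = k) X, mor (sh n (sh m X)) (sh k X);
  shD_iso : forall (m n k : int) (h : m + n = k) X, is_iso (shD h X);
  shD_nat : forall (m n k : int) (h : m + n = k) X Y (f : mor X Y),
    shD h Y ∘ shm n (shm m f) = shm k f ∘ shD h X;
  shDA : forall (a b c ab bc abc : int) (hab : a + b = ab) (hbc : b + c = bc)
      (hl : ab + c = abc) (hr : a + bc = abc) X,
    shD hl X ∘ shm c (shD hab X) = shD hr X ∘ shD hbc (sh a X);
  shD0l : forall (a : int) (h : 0 + a = a) X, shD h X = shm a (sh0 X);
  shD0r : forall (a : int) (h : a + 0 = a) X, shD h X = sh0 (sh a X) }.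

Arguments sh {s} n X.
Arguments sh0 {s} X.
Arguments sh0V {s} X.
Arguments shD {s m n k} h X.

Record triangulated := Triangulated {
  tricat :> shiftCategory;
  dist : forall X Y Z : tricat,
    mor X Y -> mor Y Z -> mor Z (sh 1 X) -> Prop;
  dist_iso : forall X Y Z X' Y' Z'
      (u : mor X Y) (v : mor Y Z) (w : mor Z (sh 1 X))
      (u' : mor X' Y') (v' : mor Y' Z') (w' : mor Z' (sh 1 X'))
      (a : mor X X') (b : mor Y Y') (c : mor Z Z'),
    is_iso a -> is_iso b -> is_iso c ->
    b ∘ u = u' ∘ a -> c ∘ v = v' ∘ b -> shm 1 a ∘ w = w' ∘ c ->
    dist u v w -> dist u' v' w';
  dist_id : forall X Z : tricat, is_zero_object Z ->
    dist (idm X) (0 : mor X Z) (0 : mor Z (sh 1 X));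
  dist_cone : forall (X Y : tricat) (u : mor X Y),
    exists (Z : tricat) (v : mor Y Z) (w : mor Z (sh 1 X)), dist u v w;
  dist_rot : forall X Y Z (u : mor X Y) (v : mor Y Z) (w : mor Z (sh 1 X)),
    dist u v w <-> dist v w (- shm 1 u);
  dist_mor : forall X Y Z X' Y' Z'
      (u : mor X Y) (v : mor Y Z) (w : mor Z (sh 1 X))
      (u' : mor X' Y') (v' : mor Y' Z') (w' : mor Z' (sh 1 X'))
      (a : mor X X') (b : mor Y Y'),
    dist u v w -> dist u' v' w' -> b ∘ u = u' ∘ a ->
    exists c : mor Z Z', c ∘ v = v' ∘ b /\ shm 1 a ∘ w = w' ∘ c;
  dist_octahedron : forall X Y Z Z' X' Y'
      (u : mor X Y) (j : mor Y Z') (k : mor Z' (sh 1 X))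
      (v : mor Y Z) (l : mor Z X') (i : mor X' (sh 1 Y))
      (m : mor Z Y') (n : mor Y' (sh 1 X)),
    dist u j k -> dist v l i -> dist (v ∘ u) m n ->
    exists (f : mor Z' Y') (g : mor Y' X'),
      [/\ dist f g (shm 1 j ∘ i), f ∘ j = m ∘ v, n ∘ f = k,
          g ∘ m = l & i ∘ g = shm 1 u ∘ n] }.

Record symMonoidal (C : preadditive) := SymMonoidal {
  tens : C -> C -> C;
  tensm : forall A A' B B' : C,
    mor A A' -> mor B B' -> mor (tens A B) (tens A' B');
  tensm1 : forall A B, tensm (idm A) (idm B) = idm (tens A B);
  tensmM : forall A A' A'' B B' B''
      (f' : mor A' A'') (f : mor A A') (g' : mor B' B'') (g : mor B B'),
    tensm (f' ∘ f) (g' ∘ g) = tensm f' g' ∘ tensm f g;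
  tensmDl : forall A A' B B' (f f' : mor A A') (g : mor B B'),
    tensm (f + f') g = tensm f g + tensm f' g;
  tensmDr : forall A A' B B' (f : mor A A') (g g' : mor B B'),
    tensm f (g + g') = tensm f g + tensm f g';
  tunit : C;
  assoc : forall A B D, mor (tens (tens A B) D) (tens A (tens B D));
  assocV : forall A B D, mor (tens A (tens B D)) (tens (tens A B) D);
  lunit : forall A, mor (tens tunit A) A;
  runit : forall A, mor (tens A tunit) A;
  braid : forall A B, mor (tens A B) (tens B A);
  assocK : forall A B D, assocV A B D ∘ assoc A B D = idm (tens (tens A B) D);
  assocVK : forall A B D, assoc A B D ∘ assocV A B D = idm (tens A (tens B D));
  lunit_iso : forall A, is_iso (lunit A);
  runit_iso : forall A, is_iso (runit A);
  assoc_nat : forall A A' B B' D D'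
      (f : mor A A') (g : mor B B') (h : mor D D'),
    assoc A' B' D' ∘ tensm (tensm f g) h
    = tensm f (tensm g h) ∘ assoc A B D;
  lunit_nat : forall A A' (f : mor A A'),
    lunit A' ∘ tensm (idm tunit) f = f ∘ lunit A;
  runit_nat : forall A A' (f : mor A A'),
    runit A' ∘ tensm f (idm tunit) = f ∘ runit A;
  braid_nat : forall A A' B B' (f : mor A A') (g : mor B B'),
    braid A' B' ∘ tensm f g = tensm g f ∘ braid A B;
  braidK : forall A B, braid B A ∘ braid A B = idm (tens A B);
  pentagon : forall A B D E,
    tensm (idm A) (assoc B D E) ∘ assoc A (tens B D) E
      ∘ tensm (assoc A B D) (idm E)
    = assoc A B (tens D E) ∘ assoc (tens A B) D E;
  triangle : forall A B,
    tensm (idm A) (lunit B) ∘ assoc A tunit B = tensm (runit A) (idm B);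
  hexagon : forall A B D,
    assoc B D A ∘ braid A (tens B D) ∘ assoc A B D
    = tensm (idm B) (braid A D) ∘ assoc B A D ∘ tensm (braid A B) (idm D) }.

Notation "f ⊠ g" := (tensm _ f g) : tt_scope.

(* [tsh] is the comparison A[1] ⊗ B -> (A ⊗ B)[1]; the one for the second
   variable, [tsh_r] below, is obtained from it by the symmetry.  [tshC] is the
   usual sign: the two comparisons A[1] ⊗ B[1] -> (A ⊗ B)[1][1] differ by -1.
   Exactness in the second variable follows from [tens_exact] by symmetry. *)
Record tensorTriangulated := TensorTriangulated {
  ttcat :> triangulated;
  mon : symMonoidal ttcat;
  tsh : forall A B : ttcat,
    mor (tens mon (sh 1 A) B) (sh 1 (tens mon A B));
  tsh_iso : forall A B, is_iso (tsh A B);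
  tsh_nat : forall A A' B B' (f : mor A A') (g : mor B B'),
    tsh A' B' ∘ tensm mon (shm 1 f) g = shm 1 (tensm mon f g) ∘ tsh A B;
  tsh_runit : forall A,
    shm 1 (runit mon A) ∘ tsh A (tunit mon) = runit mon (sh 1 A);
  tsh_assoc : forall A B D,
    shm 1 (assoc mon A B D) ∘ tsh (tens mon A B) D
      ∘ tensm mon (tsh A B) (idm D)
    = tsh A (tens mon B D) ∘ assoc mon (sh 1 A) B D;
  tshC : let tsh_r A B :=
      shm 1 (braid mon B A) ∘ tsh B A ∘ braid mon A (sh 1 B) in
    forall A B,
    shm 1 (tsh_r A B) ∘ tsh A (sh 1 B)
    = - (shm 1 (tsh A B) ∘ tsh_r (sh 1 A) B);
  tens_exact : forall X Y Z W
      (u : mor X Y) (v : mor Y Z) (w : mor Z (sh 1 X)),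
    dist u v w ->
    dist (tensm mon u (idm W)) (tensm mon v (idm W))
         (tsh X W ∘ tensm mon w (idm W)) }.

Definition tt1 {T : tensorTriangulated} : T := tunit (mon T).
Definition tensor {T : tensorTriangulated} (A B : T) : T := tens (mon T) A B.

Arguments mon : clear implicits.

Record localising (T : triangulated) (S : T -> Prop) : Prop := Localising {
  loc_iso : forall (X Y : T) (f : mor X Y), is_iso f -> S X -> S Y;
  loc_zero : forall Z : T, is_zero_object Z -> S Z;
  loc_shift : forall n (X : T), S X -> S (sh n X);
  loc_cone : forall (X Y Z : T)
      (u : mor X Y) (v : mor Y Z) (w : mor Z (sh 1 X)),
    dist u v w -> S X -> S Y -> S Z;
  loc_coprod : forall (X : nat -> T) (P : T) (i : forall n, mor (X n) P),
    is_coproduct i -> (forall n, S (X n)) -> S P }.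

Definition in_localising_generated_by (T : triangulated) (G A : T) : Prop :=
  forall S : T -> Prop, localising S -> S G -> S A.

Record duality (T : tensorTriangulated) (A : T) := Duality {
  dualobj : T;
  coev : mor tt1 (tensor A dualobj);
  ev : mor (tensor dualobj A) tt1;
  zigzag : runit (mon T) A ∘ (idm A ⊠ ev) ∘ assoc (mon T) A dualobj A
             ∘ (coev ⊠ idm A)
           = lunit (mon T) A;
  zigzag_dual :
    lunit (mon T) dualobj ∘ (ev ⊠ idm dualobj)
      ∘ assocV (mon T) dualobj A dualobj ∘ (idm dualobj ⊠ coev)
    = runit (mon T) dualobj }.

Definition dualisable (T : tensorTriangulated) (A : T) : Prop :=
  inhabited (duality A).

Definition trace (T : tensorTriangulated) (A : T) (D : duality A)
    (f : mor A A) : mor (@tt1 T) tt1 :=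
  ev D ∘ (idm (dualobj D) ⊠ f) ∘ braid (mon T) A (dualobj D) ∘ coev D.

Definition additivity_of_traces (T : tensorTriangulated) : Prop :=
  forall (A B C : T) (u : mor A B) (v : mor B C) (w : mor C (sh 1 A))
         (DA : duality A) (DB : duality B) (fA : mor A A) (fB : mor B B),
    dist u v w -> fB ∘ u = u ∘ fA ->
    exists (DC : duality C) (fC : mor C C),
      [/\ fC ∘ v = v ∘ fB, shm 1 fA ∘ w = w ∘ fC
        & trace DC fC - trace DB fB + trace DA fA = 0].

(* A graded ring or module is the family of its homogeneous components.
   Multiplication R_m x R_n -> R_k is indexed by a proof of m + n = k. *)
Record gradedRing := GradedRing {
  gr :> int -> zmodType;
  gmul : forall m n k : int, m + n = k -> gr m -> gr n -> gr k;
  gone : gr 0;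
  gmulDl : forall (m n k : int) (h : m + n = k) (x x' : gr m) (y : gr n),
    gmul h (x + x') y = gmul h x y + gmul h x' y;
  gmulDr : forall (m n k : int) (h : m + n = k) (x : gr m) (y y' : gr n),
    gmul h x (y + y') = gmul h x y + gmul h x y';
  gmulA : forall (a b c ab bc abc : int) (hab : a + b = ab) (hbc : b + c = bc)
      (hl : ab + c = abc) (hr : a + bc = abc) (x : gr a) (y : gr b) (z : gr c),
    gmul hr x (gmul hbc y z) = gmul hl (gmul hab x y) z;
  gmul1x : forall (m : int) (h : 0 + m = m) (x : gr m), gmul h gone x = x;
  gmulx1 : forall (m : int) (h : m + 0 = m) (x : gr m), gmul h x gone = x }.

(* Graded modules are right modules: on T_*(1, A), composition with elements
   of T_*(1, 1) is an action on the right.  As the ring is graded-commutative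
   there, x r = (-1)^(|x||r|) r x identifies them with left modules, with the
   same degree-zero morphisms and, up to isomorphism, the same free modules. *)
Record gradedModule (R : gradedRing) := GradedModule {
  gm :> int -> zmodType;
  gact : forall m n k : int, m + n = k -> gm m -> R n -> gm k;
  gactDl : forall (m n k : int) (h : m + n = k) (x x' : gm m) (r : R n),
    gact h (x + x') r = gact h x r + gact h x' r;
  gactDr : forall (m n k : int) (h : m + n = k) (x : gm m) (r r' : R n),
    gact h x (r + r') = gact h x r + gact h x r';
  gactA : forall (a b c ab bc abc : int) (hab : a + b = ab) (hbc : b + c = bc)
      (hl : ab + c = abc) (hr : a + bc = abc) (x : gm a) (r : R b) (s : R c),
    gact hr x (gmul hbc r s) = gact hl (gact hab x r) s;
  gact1 : forall (m : int) (h : m + 0 = m) (x : gm m), gact h x (gone R) = x }.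

Record ghom (R : gradedRing) (M N : gradedModule R) := GHom {
  gfun :> forall m, M m -> N m;
  ghomD : forall m (x y : M m), gfun (x + y) = gfun x + gfun y;
  ghomZ : forall (m n k : int) (h : m + n = k) (x : M m) (r : R n),
    gfun (gact h x r) = gact h (gfun x) r }.

Arguments gfun {R M N} g m x.

Section GradedModules.
Variable R : gradedRing.
Implicit Types M N P Q : gradedModule R.

Definition gself : gradedModule R :=
  {| gm := R; gact := @gmul R; gactDl := @gmulDl R; gactDr := @gmulDr R;
     gactA := @gmulA R; gact1 := @gmulx1 R |}.

(* Shift: M[n]_m = M_(n + m). *)

Fact gshift_idx (n m p k : int) : m + p = k -> (n + m) + p = n + k.
Proof. by move=> <-; rewrite addrA. Qed.

Definition gshift_act (n : int) M (m p k : int) (h : m + p = k)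
    (x : M (n + m)) (r : R p) : M (n + k) :=
  gact (gshift_idx n h) x r.

Fact gshift_actA n M (a b c ab bc abc : int)
    (hab : a + b = ab) (hbc : b + c = bc)
    (hl : ab + c = abc) (hr : a + bc = abc)
    (x : M (n + a)) (r : R b) (s : R c) :
  gshift_act hr x (gmul hbc r s) = gshift_act hl (gshift_act hab x r) s.
Proof. exact: gactA. Qed.

Fact gshift_act1 n M (m : int) (h : m + 0 = m) (x : M (n + m)) :
  gshift_act h x (gone R) = x.
Proof. exact: gact1. Qed.

Definition gshift (n : int) M : gradedModule R :=
  {| gm := fun m => M (n + m);
     gact := @gshift_act n M;
     gactDl := fun m p k h => @gactDl R M _ _ _ (gshift_idx n h);
     gactDr := fun m p k h => @gactDr R M _ _ _ (gshift_idx n h);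
     gactA := @gshift_actA n M;
     gact1 := @gshift_act1 n M |}.

Definition gsum_act P Q (m n k : int) (h : m + n = k)
    (x : P m * Q m) (r : R n) : (P k * Q k)%type := (gact h x.1 r, gact h x.2 r).

Fact gsum_actDl P Q (m n k : int) (h : m + n = k) (x y : P m * Q m) (r : R n) :
  gsum_act h (x + y) r = gsum_act h x r + gsum_act h y r.
Proof. by rewrite /gsum_act /= !gactDl. Qed.

Fact gsum_actDr P Q (m n k : int) (h : m + n = k) (x : P m * Q m) (r s : R n) :
  gsum_act h x (r + s) = gsum_act h x r + gsum_act h x s.
Proof. by rewrite /gsum_act !gactDr. Qed.

Fact gsum_actA P Q (a b c ab bc abc : int) (hab : a + b = ab) (hbc : b + c = bc)
    (hl : ab + c = abc) (hr : a + bc = abc)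
    (x : P a * Q a) (r : R b) (s : R c) :
  gsum_act hr x (gmul hbc r s) = gsum_act hl (gsum_act hab x r) s.
Proof.
by rewrite /gsum_act /= (gactA hab hbc hl hr x.1) (gactA hab hbc hl hr x.2).
Qed.

Fact gsum_act1 P Q (m : int) (h : m + 0 = m) (x : P m * Q m) :
  gsum_act h x (gone R) = x.
Proof. by rewrite /gsum_act !gact1 -surjective_pairing. Qed.

Definition gsum P Q : gradedModule R :=
  {| gm := fun m => (P m * Q m)%type : zmodType;
     gact := @gsum_act P Q;
     gactDl := @gsum_actDl P Q; gactDr := @gsum_actDr P Q;
     gactA := @gsum_actA P Q; gact1 := @gsum_act1 P Q |}.

End GradedModules.

(* The library has no group structure on dependent finite functions. *)

Section DependentSum.
Variables (r : nat) (V : 'I_r -> zmodType).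

Definition dsum := {dffun forall i, V i}.

HB.instance Definition _ := Choice.on dsum.

Definition dsum0 : dsum := [ffun i => 0 : V i].
Definition dsumN (x : dsum) : dsum := [ffun i => - x i : V i].
Definition dsumD (x y : dsum) : dsum := [ffun i => x i + y i : V i].

Fact dsumA : associative dsumD.
Proof. by move=> x y z; apply/ffunP => i; rewrite !ffunE addrA. Qed.
Fact dsumC : commutative dsumD.
Proof. by move=> x y; apply/ffunP => i; rewrite !ffunE addrC. Qed.
Fact dsum0x : left_id dsum0 dsumD.
Proof. by move=> x; apply/ffunP => i; rewrite !ffunE add0r. Qed.
Fact dsumNx : left_inverse dsum0 dsumN dsumD.
Proof. by move=> x; apply/ffunP => i; rewrite !ffunE addNr. Qed.

HB.instance Definition _ :=
  GRing.isZmodule.Build dsum dsumA dsumC dsum0x dsumNx.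

End DependentSum.

Section GradedModulesFinite.
Variable R : gradedRing.
Implicit Types M N P Q : gradedModule R.

Section DirectSum.
Variables (r : nat) (Ms : 'I_r -> gradedModule R).

Let D (m : int) : zmodType := dsum (fun i => Ms i m).

Definition gdsum_act (m n k : int) (h : m + n = k) (x : D m) (s : R n) : D k :=
  [ffun i => gact h (x i) s : Ms i k].

Fact gdsum_actDl (m n k : int) (h : m + n = k) (x y : D m) (s : R n) :
  gdsum_act h (x + y) s = gdsum_act h x s + gdsum_act h y s.
Proof. by apply/ffunP => i; rewrite !ffunE gactDl. Qed.

Fact gdsum_actDr (m n k : int) (h : m + n = k) (x : D m) (s t : R n) :
  gdsum_act h x (s + t) = gdsum_act h x s + gdsum_act h x t.
Proof. by apply/ffunP => i; rewrite !ffunE gactDr. Qed.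

Fact gdsum_actA (a b c ab bc abc : int) (hab : a + b = ab) (hbc : b + c = bc)
    (hl : ab + c = abc) (hr : a + bc = abc) (x : D a) (s : R b) (t : R c) :
  gdsum_act hr x (gmul hbc s t) = gdsum_act hl (gdsum_act hab x s) t.
Proof.
by apply/ffunP => i; rewrite !ffunE (gactA hab hbc hl hr (x i)).
Qed.

Fact gdsum_act1 (m : int) (h : m + 0 = m) (x : D m) :
  gdsum_act h x (gone R) = x.
Proof. by apply/ffunP => i; rewrite !ffunE gact1. Qed.

Definition gdsum : gradedModule R :=
  {| gm := D; gact := gdsum_act; gactDl := gdsum_actDl;
     gactDr := gdsum_actDr; gactA := gdsum_actA; gact1 := gdsum_act1 |}.

End DirectSum.

Definition gfree (r : nat) (ns : 'I_r -> int) : gradedModule R :=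
  gdsum (fun i => gshift (ns i) (gself R)).

Definition gsurjective M N (f : ghom M N) : Prop :=
  forall m (y : N m), exists x : M m, f m x = y.

Definition finitely_generated M : Prop :=
  exists (r : nat) (k : 'I_r -> int) (e : forall i, M (k i)),
    forall m (x : M m), exists c : forall i, R (m - k i),
      x = \sum_(i < r) gact (subrKC (k i) m) (e i) (c i).

Definition projective P : Prop :=
  forall M N (p : ghom M N) (f : ghom P N), gsurjective p ->
    exists g : ghom P M, forall m x, p m (g m x) = f m x.

Definition gzero M : Prop := forall m (x : M m), x = 0.

(* The resolution 0 -> P_l -> ... -> P_0 -> M is extended by P_j = 0 for
   j > l.  The boundary P_(j+1) -> P_j of degree one is a morphism of degree
   zero to P_j[1], and aug is the augmentation d_0. *)
Record finite_projective_resolution M := FiniteProjectiveResolution {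
  res_len : nat;
  res : nat -> gradedModule R;
  bd : forall j, ghom (res j.+1) (gshift 1 (res j));
  aug : ghom (res 0%N) M;
  res_fg : forall j, finitely_generated (res j);
  res_proj : forall j, projective (res j);
  res_finite : forall j, (res_len < j)%N -> gzero (res j);
  aug_surj : gsurjective aug;
  aug_exact : forall m (y : res 0%N (1 + m)),
    aug _ y = 0 <-> exists x : res 1%N m, bd 0 m x = y;
  bd_exact : forall j m (y : res j.+1 (1 + m)),
    bd j _ y = 0 <-> exists x : res j.+2 m, bd j.+1 m x = y }.

Definition is_lift M (g : ghom M M) (P : finite_projective_resolution M)
    (gs : forall j, ghom (res P j) (res P j)) : Prop :=
  (forall m (x : res P 0 m), aug P m (gs 0%N m x) = g m (aug P m x)) /\
  (forall j m (x : res P j.+1 m),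
     bd P j m (gs j.+1 m x) = gs j (1 + m) (bd P j m x)).

Definition gcast (m n : int) (h : m = n) (x : R m) : R n :=
  ecast k (R k) h x.

Definition gfree_in (r : nat) (ns : 'I_r -> int) (i : 'I_r) m
    (x : R (ns i + m)) : gfree ns m :=
  [ffun j => dfwith (fun j => 0 : R (ns j + m)) x j].

(* The diagonal entry psi_ii of the matrix of Psi.  An R-linear map
   R[n_i] -> R[n_i] is multiplication by its value at the generator 1, which
   lies in the component of degree - n_i of R[n_i], that is in R_0. *)
Definition diag_entry (r : nat) (ns : 'I_r -> int)
    (Psi : ghom (gfree ns) (gfree ns)) (i : 'I_r) : R 0 :=
  let e : R (ns i - ns i) := gcast (esym (subrr (ns i))) (gone R) in
  gcast (subrr (ns i)) ((Psi (- ns i) (gfree_in e) : dsum _) i).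

Definition free_trace (r : nat) (ns : 'I_r -> int)
    (Psi : ghom (gfree ns) (gfree ns)) : R 0 :=
  \sum_(i < r) diag_entry Psi i *~ ((-1) ^+ absz (ns i)).

(* [phi] is an isomorphism from P + Q to a free module that conjugates the
   endomorphism Psi + 0_Q to Phi. *)
Definition is_proj_trace P (Psi : ghom P P) (t : R 0) : Prop :=
  exists (Q : gradedModule R) (r : nat) (ns : 'I_r -> int)
         (phi : ghom (gsum P Q) (gfree ns)) (phiV : ghom (gfree ns) (gsum P Q))
         (Phi : ghom (gfree ns) (gfree ns)),
    [/\ forall m x, phiV m (phi m x) = x,
        forall m y, phi m (phiV m y) = y,
        forall m (x : P m) (y : Q m), Phi m (phi m (x, y)) = phi m (Psi m x, 0)
      & t = free_trace Phi].

Definition is_HS_trace M (g : ghom M M) (t : R 0) : Prop :=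
  exists (P : finite_projective_resolution M)
         (gs : forall j, ghom (res P j) (res P j)) (ts : nat -> R 0),
    [/\ is_lift g gs, forall j, is_proj_trace (gs j) (ts j)
      & t = \sum_(j < (res_len P).+1) ts j].

End GradedModulesFinite.

Section GradedHom.
Variable T : shiftCategory.
Implicit Types A B C : T.

(* T_n(A, B) = T(A, B[n]). *)
Definition homn (n : int) A B : zmodType := mor A (sh n B).

Definition compn A B C (m n k : int) (h : m + n = k)
    (g : homn m B C) (f : homn n A B) : homn k A C :=
  shD h C ∘ (shm n g ∘ f).

Fact compnDl A B C (m n k : int) (h : m + n = k)
    (g g' : homn m B C) (f : homn n A B) :
  compn h (g + g') f = compn h g f + compn h g' f.
Proof. by rewrite /compn shmD compDl compDr. Qed.

Fact compnDr A B C (m n k : int) (h : m + n = k)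
    (g : homn m B C) (f f' : homn n A B) :
  compn h g (f + f') = compn h g f + compn h g f'.
Proof. by rewrite /compn !compDr. Qed.

Fact compnA A B C D (a b c ab bc abc : int)
    (hab : a + b = ab) (hbc : b + c = bc)
    (hl : ab + c = abc) (hr : a + bc = abc)
    (x : homn a C D) (y : homn b B C) (z : homn c A B) :
  compn hr x (compn hbc y z) = compn hl (compn hab x y) z.
Proof.
rewrite /compn !shmM !compA (shDA hab hbc hl hr); congr (_ ∘ _ ∘ _).
by rewrite -!compA shD_nat.
Qed.

Fact comp1n A B (m : int) (h : 0 + m = m) (f : homn m A B) :
  compn h (sh0V B) f = f.
Proof. by rewrite /compn shD0l compA -shmM sh0VK shm1 comp1m. Qed.

Fact compn1 A B (m : int) (h : m + 0 = m) (f : homn m A B) :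
  compn h f (sh0V A) = f.
Proof. by rewrite /compn shD0r compA sh0_nat -compA sh0VK compm1. Qed.

Definition gEnd A : gradedRing :=
  {| gr := fun n => homn n A A; gmul := @compn A A A; gone := sh0V A;
     gmulDl := @compnDl A A A; gmulDr := @compnDr A A A;
     gmulA := @compnA A A A A; gmul1x := @comp1n A A; gmulx1 := @compn1 A A |}.

Definition gHom A B : gradedModule (gEnd A) :=
  @GradedModule (gEnd A) (fun n => homn n A B) (@compn A A B)
    (@compnDl A A B) (@compnDr A A B) (@compnA A A A B) (@compn1 A B).

Definition gHom_fun A B (F : mor B B) m (x : homn m A B) : homn m A B :=
  shm m F ∘ x.

Fact gHom_funD A B (F : mor B B) m (x y : homn m A B) :
  gHom_fun F (x + y) = gHom_fun F x + gHom_fun F y.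
Proof. exact: compDr. Qed.

Fact gHom_funZ A B (F : mor B B) (m n k : int) (h : m + n = k)
    (x : homn m A B) (r : homn n A A) :
  gHom_fun F (compn h x r) = compn h (gHom_fun F x) r.
Proof. by rewrite /gHom_fun /compn shmM !compA shD_nat. Qed.

Definition gHom_map A B (F : mor B B) : ghom (gHom A B) (gHom A B) :=
  {| gfun := @gHom_fun A B F : forall m, gHom A B m -> gHom A B m;
     ghomD := @gHom_funD A B F; ghomZ := @gHom_funZ A B F |}.

End GradedHom.

(* R = T_*(1, 1), M(A) = T_*(1, A), and T_*(1, F). *)
Definition Rgr (T : tensorTriangulated) : gradedRing := gEnd (@tt1 T).
Definition Mgr (T : tensorTriangulated) (A : T) : gradedModule (Rgr T) :=
  gHom tt1 A.
Definition Mgr_map (T : tensorTriangulated) (A : T) (F : mor A A) :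
  ghom (Mgr A) (Mgr A) := gHom_map tt1 F.

(* The identification of T(1, 1) with R_0 = T(1, 1[0]). *)
Definition to_R0 (T : tensorTriangulated) (t : mor (@tt1 T) tt1) : Rgr T 0 :=
  sh0V tt1 ∘ t.

(* Main.v *)
From mathcomp Require Import all_boot all_order all_algebra.
Require Import Defs.

Set Implicit Arguments.
Unset Strict Implicit.
Unset Printing Implicit Defensive.

Import GRing.Theory.
Local Open Scope ring_scope.
Local Open Scope tt_scope.

(* Write M(X) for T_*(1, X).  The first term P_0 of a projective resolution of
   M(A) is M(B) for a retract B of a finite sum of shifts of 1, and M is fully
   faithful on such B.  The augmentation thus comes from a map e : B -> A whose
   cone C satisfies M(C) = ker(P_0[1] -> M(A)[1]), so that the rest of the
   resolution is a resolution of M(C) that is shorter by one step; additivity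
   gives tr F = tr f_B + tr f_C.  The induction ends with M(A) = 0, where A = 0
   because A is built from 1.

   Additivity applied to the cone of a split monomorphism i also yields
   tr (i g) = tr (g i), hence independence of the chosen duality and, together
   with the sign of a shift, the trace of a matrix on a sum of shifts of 1. *)

(** * Preadditive categories with shift *)

(** The obstacle is that additivity provides some [f_C], with no control over which. The induction
    is therefore stated for every endomorphism and every lift of it: as [M(C)] embeds in [P_0[1]],
    the remaining terms of any lift automatically lift [M(f_C)]. Independence of the
    Hattori-Stallings trace from its choices is then never proved on the algebraic side; every
    choice evaluates to [tr F]. Each step uses two triangles. Write [C = X[1]]. The cone of [X -> B]
    is [A], which makes [A] dualisable; only then does additivity apply to [B -> A -> X[1]]. The
    induction speaks of [X[1]] while the first triangle needs [X], so dualisability is carried along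
    for all shifts. With [X[1]] as third object the traces add without a sign, in agreement with
    boundaries of degree one. *)

Section Preadditive.
Variable C : preadditive.
Implicit Types X Y Z W : C.

Lemma comp0m X Y Z (f : mor X Y) : (0 : mor Y Z) ∘ f = 0.
Proof. by apply: (@addrI _ (0 ∘ f)); rewrite -compDl !addr0. Qed.

Lemma compm0 X Y Z (f : mor Y Z) : f ∘ (0 : mor X Y) = 0.
Proof. by apply: (@addrI _ (f ∘ 0)); rewrite -compDr !addr0. Qed.

Lemma compNm X Y Z (g : mor Y Z) (f : mor X Y) : (- g) ∘ f = - (g ∘ f).
Proof. by apply/eqP; rewrite -addr_eq0 -compDl addNr comp0m. Qed.

Lemma compmN X Y Z (g : mor Y Z) (f : mor X Y) : g ∘ (- f) = - (g ∘ f).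
Proof. by apply/eqP; rewrite -addr_eq0 -compDr addNr compm0. Qed.

Lemma compBl X Y Z (g g' : mor Y Z) (f : mor X Y) :
  (g - g') ∘ f = g ∘ f - g' ∘ f.
Proof. by rewrite compDl compNm. Qed.

Lemma compBr X Y Z (g : mor Y Z) (f f' : mor X Y) :
  g ∘ (f - f') = g ∘ f - g ∘ f'.
Proof. by rewrite compDr compmN. Qed.

Lemma comp_suml X Y Z I (r : seq I) (P : pred I) (F : I -> mor Y Z)
    (f : mor X Y) :
  (\sum_(i <- r | P i) F i) ∘ f = \sum_(i <- r | P i) F i ∘ f.
Proof.
apply: (big_morph (fun g => g ∘ f)) => [g g'|]; first exact: compDl.
exact: comp0m.
Qed.

Lemma comp_sumr X Y Z I (r : seq I) (P : pred I) (F : I -> mor X Y)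
    (g : mor Y Z) :
  g ∘ (\sum_(i <- r | P i) F i) = \sum_(i <- r | P i) g ∘ F i.
Proof.
apply: (big_morph (fun f => g ∘ f)) => [f f'|]; first exact: compDr.
exact: compm0.
Qed.

(** Composition associates to the left, so [a ∘ b] is not a subterm of [x ∘ a ∘ b]; this and
    [compE2] rewrite such a pair in place. *)
Lemma compE X Y Z W (a : mor Y Z) (b : mor X Y) (c : mor X Z) (x : mor Z W) :
  a ∘ b = c -> x ∘ a ∘ b = x ∘ c.
Proof. by move=> <-; rewrite compA. Qed.

Lemma compE2 X Y Y' Z W (a : mor Y Z) (b : mor X Y) (c : mor Y' Z)
    (d : mor X Y') (x : mor Z W) :
  a ∘ b = c ∘ d -> x ∘ a ∘ b = x ∘ c ∘ d.
Proof. by move=> e; rewrite -!compA e. Qed.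

(** Morphism groups are choice types: with boolean equations, [xchoose] extracts an inverse without
    a choice axiom. *)
Lemma is_iso_ex X Y (f : mor X Y) : is_iso f ->
  exists g : mor Y X, (g ∘ f == idm X) && (f ∘ g == idm Y).
Proof. by case=> g /eqP gf /eqP fg; exists g; rewrite gf. Qed.

Definition isoV X Y (f : mor X Y) (h : is_iso f) : mor Y X :=
  xchoose (is_iso_ex h).

Lemma isoVK X Y (f : mor X Y) (h : is_iso f) : isoV h ∘ f = idm X.
Proof. by case/andP: (xchooseP (is_iso_ex h)) => /eqP. Qed.

Lemma isoKV X Y (f : mor X Y) (h : is_iso f) : f ∘ isoV h = idm Y.
Proof. by case/andP: (xchooseP (is_iso_ex h)) => _ /eqP. Qed.

Lemma isoV_iso X Y (f : mor X Y) (h : is_iso f) : is_iso (isoV h).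
Proof. by exists f; rewrite ?isoVK ?isoKV. Qed.

Lemma iso_epi X Y Z (f : mor X Y) (g h : mor Y Z) :
  is_iso f -> g ∘ f = h ∘ f -> g = h.
Proof. by case=> k _ fk e; rewrite -[g]compm1 -[h]compm1 -fk !compA e. Qed.

Lemma iso_mono X Y Z (f : mor Y Z) (g h : mor X Y) :
  is_iso f -> f ∘ g = f ∘ h -> g = h.
Proof. by case=> k kf _ e; rewrite -[g]comp1m -[h]comp1m -kf -!compA e. Qed.

Lemma iso_id X : is_iso (idm X).
Proof. by exists (idm X); rewrite compm1. Qed.

Lemma iso_comp X Y Z (g : mor Y Z) (f : mor X Y) :
  is_iso g -> is_iso f -> is_iso (g ∘ f).
Proof.
move=> [g' g'g gg'] [f' f'f ff']; exists (f' ∘ g').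
  by rewrite compA -(compA f') g'g compm1.
by rewrite compA -(compA g) ff' compm1.
Qed.

(** Dualisability depends only on the existence of an isomorphism, so no coherent comparison of,
    say, [A[n] ⊗ B] with [(A ⊗ B)[n]] has to be recorded. *)
Definition sim X Y := exists f : mor X Y, is_iso f.

Lemma simxx X : sim X X.
Proof. by exists (idm X); exact: iso_id. Qed.

Lemma sim_sym X Y : sim X Y -> sim Y X.
Proof. by case=> f h; exists (isoV h); exact: isoV_iso. Qed.

Lemma sim_trans Y X Z : sim X Y -> sim Y Z -> sim X Z.
Proof. by case=> f hf [g hg]; exists (g ∘ f); exact: iso_comp. Qed.

Definition fam_biproduct (I : finType) (X : I -> C) (P : C)
    (i : forall k, mor (X k) P) (p : forall k, mor P (X k)) : Prop :=
  [/\ forall k, p k ∘ i k = idm (X k),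
      forall k l, k != l -> p k ∘ i l = 0
    & \sum_k i k ∘ p k = idm P].

Lemma zero_object0 Z : is_zero_object Z -> idm Z = 0.
Proof. by move=> hZ; case: (hZ Z). Qed.

Lemma zero_objectE Z : idm Z = 0 -> is_zero_object Z.
Proof.
move=> e X; split=> f; first by rewrite -[f]comp1m e comp0m.
by rewrite -[f]compm1 e compm0.
Qed.

End Preadditive.

Section ShiftCategory.
Variable C : shiftCategory.
Implicit Types X Y Z W : C.

Lemma fam_biproduct_exists (I : finType) (X : I -> C) :
  exists (P : C) (i : forall k, mor (X k) P) (p : forall k, mor P (X k)),
    fam_biproduct i p.
Proof.
(* Induction on the enumeration: an index not yet reached carries zero maps, so off-diagonal
   composites vanish throughout, while the identities hold on the indices already listed. *)
have [P [i [p [h1 h2 h3]]]] : exists (P : C) (i : forall k, mor (X k) P)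
    (p : forall k, mor P (X k)),
    [/\ forall k, k \in index_enum I -> p k ∘ i k = idm (X k),
        forall k l, k != l -> p k ∘ i l = 0
      & \sum_(k <- index_enum I) i k ∘ p k = idm P].
  elim: (index_enum I) (index_enum_uniq I) => [_|a s IH /andP[nas us]].
    have [Z hZ] := zero_objectP C.
    exists Z, (fun k => 0), (fun k => 0); split=> //.
      by move=> k l _; rewrite compm0.
    by rewrite big_nil zero_object0.
  have [P [i [p [h1 h2 h3]]]] := IH us.
  have [Q [i1 [i2 [p1 [p2 [e11 e22 e21 e12 eQ]]]]]] := biproductP (X a) P.
  exists Q, (dfwith (fun k => i2 ∘ i k) i1), (dfwith (fun k => p k ∘ p2) p1).
  split.
  - move=> k; rewrite inE; case: (eqVneq k a) => [->|nka] /= hk.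
      by rewrite !dfwith_in.
    rewrite !dfwith_out 1?eq_sym // !compA -(compA (p k)) e22 compm1.
    exact: h1.
  - move=> k l nkl; case: (eqVneq k a) => [eka|nka].
      subst k; rewrite dfwith_in dfwith_out // compA e12 comp0m //.
    case: (eqVneq l a) => [ela|nla].
      subst l; rewrite dfwith_in dfwith_out 1?eq_sym //.
      by rewrite -compA e21 compm0.
    rewrite !dfwith_out 1?eq_sym // compA -(compA (p k)) e22 compm1.
    exact: h2.
  - rewrite big_cons !dfwith_in -eQ -[X in i2 ∘ X]comp1m -h3.
    rewrite comp_suml comp_sumr; congr (_ + _).
    apply: eq_big_seq => k ks.
    have nka : a != k by apply: contraNneq nas => ->.
    by rewrite !dfwith_out // !compA.
by exists P, i, p; split=> // k; exact: h1 (mem_index_enum k).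
Qed.

Lemma shm0 n X Y : shm n (0 : mor X Y) = 0.
Proof. by apply: (@addrI _ (shm n 0)); rewrite -shmD !addr0. Qed.

Lemma shmN n X Y (f : mor X Y) : shm n (- f) = - shm n f.
Proof. by apply/eqP; rewrite -addr_eq0 -shmD addNr shm0. Qed.

Lemma shm_sum n X Y I (r : seq I) (P : pred I) (F : I -> mor X Y) :
  shm n (\sum_(i <- r | P i) F i) = \sum_(i <- r | P i) shm n (F i).
Proof.
by apply: (big_morph (@shm C n X Y)) => [f g|]; [exact: shmD | exact: shm0].
Qed.

Lemma shm_iso n X Y (f : mor X Y) : is_iso f -> is_iso (shm n f).
Proof. by case=> g gf fg; exists (shm n g); rewrite -shmM ?gf ?fg shm1. Qed.

Lemma sh0_iso X : is_iso (sh0 X).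
Proof. by exists (sh0V X); rewrite ?sh0K ?sh0VK. Qed.

Lemma sh0V_nat X Y (f : mor X Y) : sh0V Y ∘ f = shm 0 f ∘ sh0V X.
Proof.
apply: (iso_mono (sh0_iso Y)).
by rewrite !compA sh0VK sh0_nat comp1m -compA sh0VK compm1.
Qed.

Lemma sh_sim n X Y : sim X Y -> sim (sh n X) (sh n Y).
Proof. by case=> f hf; exists (shm n f); exact: shm_iso. Qed.

Lemma sh0_sim X : sim (sh 0 X) X.
Proof. by exists (sh0 X); exact: sh0_iso. Qed.

Lemma shD_sim m n X : sim (sh n (sh m X)) (sh (m + n) X).
Proof. by exists (shD erefl X); exact: shD_iso. Qed.

(** Being natural and invertible, this comparison makes every [sh n] full and faithful. *)
Definition unsh (n m : int) (h : n + m = 0) X : mor (sh m (sh n X)) X :=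
  sh0 X ∘ shD h X.

Lemma unsh_iso n m (h : n + m = 0) X : is_iso (unsh h X).
Proof. by apply: iso_comp; [exact: sh0_iso | exact: shD_iso]. Qed.

Lemma unsh_nat n m (h : n + m = 0) X Y (f : mor X Y) :
  unsh h Y ∘ shm m (shm n f) = f ∘ unsh h X.
Proof. by rewrite /unsh -compA shD_nat !compA sh0_nat. Qed.

Lemma shm_inj n X Y (f g : mor X Y) : shm n f = shm n g -> f = g.
Proof.
move=> e; have h := subrr n; apply: (iso_epi (unsh_iso h X)).
by rewrite -!unsh_nat e.
Qed.

Lemma shm_full n X Y (g : mor (sh n X) (sh n Y)) :
  exists f : mor X Y, shm n f = g.
Proof.
have h := subrr n; have hX := unsh_iso h X.
exists (unsh h Y ∘ shm (- n) g ∘ isoV hX).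
apply: (@shm_inj (- n)); apply: (iso_mono (unsh_iso h Y)).
by rewrite unsh_nat -compA isoVK compm1.
Qed.

Lemma sh_zero n Z : is_zero_object Z -> is_zero_object (sh n Z).
Proof.
by move=> hZ; apply: zero_objectE; rewrite -shm1 zero_object0 ?shm0.
Qed.

Lemma fam_biproduct_sh n (I : finType) (X : I -> C) P
    (i : forall k, mor (X k) P) (p : forall k, mor P (X k)) :
  fam_biproduct i p ->
  fam_biproduct (fun k => shm n (i k)) (fun k => shm n (p k)).
Proof.
case=> h1 h2 h3; split=> [k|k l kl|]; first by rewrite -shmM h1 shm1.
  by rewrite -shmM h2 // shm0.
by rewrite -shm1 -h3 shm_sum; apply: eq_bigr => k _; rewrite shmM.
Qed.

End ShiftCategory.

(** * Triangles and idempotents *)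

Section Triangulated.
Variable T : triangulated.
Implicit Types X Y Z W : T.

Lemma dist_comp0 X Y Z (u : mor X Y) (v : mor Y Z) (w : mor Z (sh 1 X)) :
  dist u v w -> v ∘ u = 0.
Proof.
move=> huvw; have [O hO] := zero_objectP T.
have [|c [e _]] := dist_mor (a := idm X) (b := u) (dist_id X hO) huvw.
  by rewrite !compm1.
by rewrite -e compm0.
Qed.

Lemma dist_rot1 X Y Z (u : mor X Y) (v : mor Y Z) (w : mor Z (sh 1 X)) :
  dist u v w -> dist v w (- shm 1 u).
Proof. by move/dist_rot. Qed.

Lemma dist_0id W O : is_zero_object O ->
  dist (0 : mor O W) (idm W) (0 : mor W (sh 1 O)).
Proof.
move=> hO; apply/dist_rot; rewrite shm0 oppr0; apply: dist_id.
exact: sh_zero.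
Qed.

Lemma weak_cokernel X Y Z W (u : mor X Y) (v : mor Y Z) (w : mor Z (sh 1 X))
    (f : mor Y W) :
  dist u v w -> f ∘ u = 0 -> exists g : mor Z W, g ∘ v = f.
Proof.
move=> huvw fu; have [O hO] := zero_objectP T.
have [|g [e _]] := dist_mor (a := 0) (b := f) huvw (dist_0id W hO).
  by rewrite fu comp0m.
by exists g; rewrite e comp1m.
Qed.

(** [dist_mor] supplies only the third morphism, so both triangles are rotated to put the unknown
    there; it comes out as a map between shifts and is pulled back by [shm_full]. *)
Lemma weak_kernel X Y Z W (u : mor X Y) (v : mor Y Z) (w : mor Z (sh 1 X))
    (f : mor W Y) :
  dist u v w -> v ∘ f = 0 -> exists g : mor W X, u ∘ g = f.
Proof.
move=> huvw vf; have [O hO] := zero_objectP T.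
have h := dist_rot1 (dist_id W hO).
have [|c [_]] := dist_mor (a := f) (b := 0) h (dist_rot1 huvw).
  by rewrite vf comp0m.
have [g <-] := shm_full c.
rewrite shm1 compmN compm1 compNm -shmM => /oppr_inj /shm_inj ->.
by exists g.
Qed.

Lemma fibre_exists Y Z (v : mor Y Z) :
  exists (X : T) (u : mor X Y) (w : mor Z (sh 1 X)), dist u v w.
Proof.
have [K [w [k hk]]] := dist_cone v.
pose a := isoV (unsh_iso (addNr 1 : -1 + 1 = 0) K).
have ha : is_iso a by exact: isoV_iso.
(* The sign cancels the one that [dist_rot] puts on [shm 1 u]. *)
have [u hu] := shm_full (- (k ∘ isoV ha)).
exists (sh (-1) K), u, (a ∘ w); apply/dist_rot.
apply: (dist_iso (iso_id Y) (iso_id Z) ha) hk; rewrite ?comp1m ?compm1 //.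
by rewrite shm1 comp1m hu opprK -compA isoVK compm1.
Qed.

(** A retraction of [u] forces [w = 0], because [u[1] ∘ w = 0]; and a morphism that kills [v]
    factors through [w]. *)
Lemma split_mono_epi X Y Z W (u : mor X Y) (v : mor Y Z) (w : mor Z (sh 1 X))
    (r : mor Y X) (f g : mor Z W) :
  dist u v w -> r ∘ u = idm X -> f ∘ v = g ∘ v -> f = g.
Proof.
move=> huvw ru efg; apply/eqP; rewrite -subr_eq0; apply/eqP.
have h : (f - g) ∘ v = 0 by rewrite compBl efg subrr.
have [k <-] := weak_cokernel (dist_rot1 huvw) h.
have h2 := dist_comp0 (dist_rot1 (dist_rot1 huvw)).
suff -> : w = 0 by rewrite compm0.
rewrite compNm in h2; move/eqP: h2; rewrite oppr_eq0 => /eqP h2.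
by rewrite -[w]comp1m -shm1 -ru shmM -compA h2 compm0.
Qed.

Lemma coproduct_eq (X : nat -> T) P (i : forall n, mor (X n) P) W
    (f g : mor P W) :
  is_coproduct i -> (forall n, f ∘ i n = g ∘ i n) -> f = g.
Proof.
move=> hi e; have [h [_ uniq]] := hi W (fun n => g ∘ i n).
by rewrite -(uniq f e); apply: uniq.
Qed.

Lemma coproduct_desc (X : nat -> T) P (i : forall n, mor (X n) P) W
    (f : forall n, mor (X n) W) :
  is_coproduct i -> exists g : mor P W, forall n, g ∘ i n = f n.
Proof. by move=> hi; have [g [hg _]] := hi W f; exists g. Qed.

(* The splitting is the homotopy colimit of L -e-> L -e-> ...: the map 1 - s e
   on the countable power of L is invertible on the image of 1 - e and has the
   retraction i_n |-> - (i_0 + ... + i_(n-1)) on the image of e, so that the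
   cone map v is an epimorphism. *)
Lemma idempotent_split (L : T) (e : mor L L) :
  has_countable_coproducts T -> e ∘ e = e ->
  exists (B : T) (j : mor L B) (q : mor B L),
    j ∘ q = idm B /\ q ∘ j = e.
Proof.
move=> hc ee; have [X [i hi]] := hc (fun _ => L).
have [u hu] := coproduct_desc (fun n => i n - i n.+1 ∘ e) hi.
have [p hp] := coproduct_desc (fun n => e) hi.
have [r hr] := coproduct_desc
  (fun n => i n ∘ (idm L - e) - \sum_(k < n) i k ∘ e) hi.
have ru : r ∘ u = idm X.
  apply: (coproduct_eq hi) => n; rewrite -compA hu compBr compA !hr.
  rewrite compBl -compA compBl comp1m ee subrr compm0 sub0r opprK.
  rewrite comp_suml (eq_bigr (fun k : 'I_n.+1 => i k ∘ e)); last first.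
    by move=> k _; rewrite -compA ee.
  by rewrite big_ord_recr /= addrA subrK compBr compm1 subrK comp1m.
have [B [v [w huvw]]] := dist_cone u.
have pu : p ∘ u = 0.
  apply: (coproduct_eq hi) => n.
  by rewrite -compA hu compBr compA !hp ee subrr comp0m.
have [q hq] := weak_cokernel huvw pu.
have vi n : v ∘ i n = v ∘ i n.+1 ∘ e.
  apply/eqP; rewrite -subr_eq0 -compA -compBr -hu compA.
  by rewrite (dist_comp0 huvw) comp0m.
have vie n : v ∘ i n ∘ e = v ∘ i n by rewrite vi -!compA ee.
have vi0 n : v ∘ i n = v ∘ i 0%N.
  by elim: n => [|n IH] //; rewrite -vie -vi.
have qj : q ∘ (v ∘ i 0%N) = e by rewrite compA hq hp.
exists B, (v ∘ i 0%N), q; split=> //.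
apply: (split_mono_epi huvw ru); apply: (coproduct_eq hi) => n.
by rewrite comp1m -!compA (compA q v) hq hp compA vie vi0.
Qed.

End Triangulated.

(** * Coherence and zigzags *)

Section Monoidal.
Variables (C : preadditive) (M : symMonoidal C).
Implicit Types A B D E X Y Z : C.
Local Notation "A ⊗ B" := (tens M A B) (at level 38, left associativity).
Local Notation I := (tunit M).
Local Notation α := (assoc M).
Local Notation λ := (lunit M).
Local Notation ρ := (runit M).

Lemma assoc_iso A B D : is_iso (α A B D).
Proof. by exists (assocV M A B D); rewrite ?assocK ?assocVK. Qed.

Lemma tens_iso A A' B B' (f : mor A A') (g : mor B B') :
  is_iso f -> is_iso g -> is_iso (tensm M f g).
Proof.
move=> [f' f'f ff'] [g' g'g gg'].
by exists (f' ⊠ g'); rewrite -tensmM ?f'f ?ff' ?g'g ?gg' tensm1.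
Qed.

Lemma braid_iso A B : is_iso (braid M A B).
Proof. by exists (braid M B A); rewrite braidK. Qed.

Lemma tensm_l A B A' A'' (f : mor A' A'') (g : mor A A') :
  (f ∘ g) ⊠ idm B = (f ⊠ idm B) ∘ (g ⊠ idm B) :> mor (A ⊗ B) (A'' ⊗ B).
Proof. by rewrite -tensmM comp1m. Qed.

Lemma tensm_r A B A' A'' (f : mor A' A'') (g : mor A A') :
  idm B ⊠ (f ∘ g) = (idm B ⊠ f) ∘ (idm B ⊠ g) :> mor (B ⊗ A) (B ⊗ A'').
Proof. by rewrite -tensmM comp1m. Qed.

Lemma tensm_lr A A' B B' (f : mor A A') (g : mor B B') :
  (f ⊠ idm B') ∘ (idm A ⊠ g) = f ⊠ g :> mor (A ⊗ B) (A' ⊗ B').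
Proof. by rewrite -tensmM comp1m compm1. Qed.

Lemma tensm_rl A A' B B' (f : mor A A') (g : mor B B') :
  (idm A' ⊠ g) ∘ (f ⊠ idm B) = f ⊠ g :> mor (A ⊗ B) (A' ⊗ B').
Proof. by rewrite -tensmM comp1m compm1. Qed.

Lemma tens0m A A' B B' (g : mor B B') : (0 : mor A A') ⊠ g = 0 :> mor (A ⊗ B) _.
Proof.
by apply: (@addrI _ (tensm M (0 : mor A A') g)); rewrite -tensmDl !addr0.
Qed.

Lemma tensm0 A A' B B' (f : mor A A') : f ⊠ (0 : mor B B') = 0 :> mor (A ⊗ B) _.
Proof.
by apply: (@addrI _ (tensm M f (0 : mor B B'))); rewrite -tensmDr !addr0.
Qed.

Lemma tens1_inj A B (f g : mor A B) :
  idm I ⊠ f = idm I ⊠ g :> mor (I ⊗ A) _ -> f = g.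
Proof.
move=> e; apply: (iso_epi (lunit_iso M A)).
by rewrite -!lunit_nat e.
Qed.

Lemma tensm1_inj A B (f g : mor A B) :
  f ⊠ idm I = g ⊠ idm I :> mor (A ⊗ I) _ -> f = g.
Proof.
move=> e; apply: (iso_epi (runit_iso M A)).
by rewrite -!runit_nat e.
Qed.

(* Kelly: the pentagon and the triangle imply the other unit coherences. *)
Lemma lunit_tens A B : λ (A ⊗ B) ∘ α I A B = λ A ⊠ idm B.
Proof.
apply: tens1_inj; rewrite tensm_r.
have h : is_iso (α I (I ⊗ A) B ∘ (α I I A ⊠ idm B)).
  apply: iso_comp; first exact: assoc_iso.
  by apply: tens_iso; [exact: assoc_iso | exact: iso_id].
apply: (iso_epi h); rewrite compA -(compA (idm I ⊠ λ _)) -compA.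
rewrite -(compA _ (α I (I ⊗ A) B)) (compA (idm I ⊠ α _ _ _)) pentagon.
rewrite compA triangle compA -assoc_nat -compA -tensm_l triangle.
by rewrite -tensm1 assoc_nat.
Qed.

Lemma runit_tens A B : (idm A ⊠ ρ B) ∘ α A B I = ρ (A ⊗ B).
Proof.
apply: tensm1_inj; rewrite tensm_l.
apply: (iso_mono (assoc_iso A B I)).
rewrite compA assoc_nat -triangle tensm_r -!compA.
rewrite (compA (idm A ⊠ α _ _ _)) pentagon -triangle compA.
by rewrite -assoc_nat tensm1 compA.
Qed.

Lemma lunit_runit : λ I = ρ I.
Proof.
apply: tens1_inj; apply: (iso_epi (assoc_iso I I I)).
rewrite triangle runit_tens; apply: (iso_mono (runit_iso M I)).
by rewrite runit_nat.
Qed.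

(** The hexagon at [(A, I, I)], tested after tensoring with the unit, where [lunit_tens] accounts
    for the associators. *)
Lemma lunit_braid A : λ A ∘ braid M A I = ρ A.
Proof.
apply: tensm1_inj; rewrite tensm_l.
apply: (iso_mono (braid_iso A I)).
rewrite -[in RHS]triangle [RHS]compA braid_nat -(lunit_tens I A).
rewrite -[RHS]compA -[RHS]compA (compA (α I I A)) hexagon -(lunit_tens A I).
by rewrite !compA lunit_nat.
Qed.

Definition lunitV A := isoV (lunit_iso M A).
Definition runitV A := isoV (runit_iso M A).

(* The zigzag composites; a duality is a pair (c, v) for which both are 1. *)
Definition Rm X Y Z (c : mor I (X ⊗ Y)) (v : mor (Y ⊗ Z) I) : mor Z X :=
  ρ X ∘ (idm X ⊠ v) ∘ α X Y Z ∘ (c ⊠ idm Z) ∘ lunitV Z.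

Definition Lm X Y Y' (v : mor (Y ⊗ X) I) (c : mor I (X ⊗ Y')) : mor Y Y' :=
  λ Y' ∘ (v ⊠ idm Y') ∘ assocV M Y X Y' ∘ (idm Y ⊠ c) ∘ runitV Y.

Lemma lunitV_nat A B (f : mor A B) :
  lunitV B ∘ f = (idm I ⊠ f) ∘ lunitV A.
Proof.
apply: (iso_mono (lunit_iso M B)).
by rewrite !compA isoKV comp1m lunit_nat -compA isoKV compm1.
Qed.

Lemma runitV_nat A B (f : mor A B) :
  runitV B ∘ f = (f ⊠ idm I) ∘ runitV A.
Proof.
apply: (iso_mono (runit_iso M B)).
by rewrite !compA isoKV comp1m runit_nat -compA isoKV compm1.
Qed.

Lemma assocV_nat A A' B B' D D' (f : mor A A') (g : mor B B') (h : mor D D') :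
  assocV M A' B' D' ∘ (f ⊠ (g ⊠ h)) = (f ⊠ g ⊠ h) ∘ assocV M A B D.
Proof.
apply: (iso_mono (assoc_iso A' B' D')).
by rewrite !compA assocVK comp1m assoc_nat -compA assocVK compm1.
Qed.

Lemma RmD X Y Z (c c' : mor I (X ⊗ Y)) (v : mor (Y ⊗ Z) I) :
  Rm (c + c') v = Rm c v + Rm c' v.
Proof. by rewrite /Rm tensmDl compDr compDl. Qed.

Lemma Rm0 X Y Z (v : mor (Y ⊗ Z) I) : Rm (0 : mor I (X ⊗ Y)) v = 0.
Proof. by rewrite /Rm tens0m compm0 comp0m. Qed.

Lemma Rm_mDr X Y Z (c : mor I (X ⊗ Y)) (v v' : mor (Y ⊗ Z) I) :
  Rm c (v + v') = Rm c v + Rm c v'.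
Proof. by rewrite /Rm tensmDr compDr !compDl. Qed.

Lemma Rm_m0 X Y Z (c : mor I (X ⊗ Y)) : Rm c (0 : mor (Y ⊗ Z) I) = 0.
Proof. by rewrite /Rm tensm0 compm0 !comp0m. Qed.

Lemma LmD X Y Y' (v v' : mor (Y ⊗ X) I) (c : mor I (X ⊗ Y')) :
  Lm (v + v') c = Lm v c + Lm v' c.
Proof. by rewrite /Lm tensmDl compDr !compDl. Qed.

Lemma Lm0 X Y Y' (c : mor I (X ⊗ Y')) : Lm (0 : mor (Y ⊗ X) I) c = 0.
Proof. by rewrite /Lm tens0m compm0 !comp0m. Qed.

(** This and the next identities move a morphism through a zigzag, so that retracts and biproducts
    are treated without touching coherence isomorphisms. *)
Lemma Rm_coev X X' Y Z (f : mor X X') (c : mor I (X ⊗ Y))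
    (v : mor (Y ⊗ Z) I) :
  Rm ((f ⊠ idm Y) ∘ c) v = f ∘ Rm c v.
Proof.
rewrite /Rm tensm_l !compA (compE2 _ (assoc_nat M f (idm Y) (idm Z))) tensm1.
rewrite (compE _ (tensm_rl f v)) -(compE _ (tensm_lr f v)).
by rewrite runit_nat.
Qed.

Lemma Rm_dual X Y Y' Z (g : mor Y Y') (c : mor I (X ⊗ Y))
    (v : mor (Y' ⊗ Z) I) :
  Rm ((idm X ⊠ g) ∘ c) v = Rm c (v ∘ (g ⊠ idm Z)).
Proof.
rewrite /Rm tensm_l tensm_r !compA.
by rewrite (compE2 _ (assoc_nat M (idm X) g (idm Z))).
Qed.

Lemma Rm_ev X Y Z Z' (c : mor I (X ⊗ Y)) (v : mor (Y ⊗ Z) I) (k : mor Z' Z) :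
  Rm c (v ∘ (idm Y ⊠ k)) = Rm c v ∘ k.
Proof.
rewrite /Rm -[RHS]compA lunitV_nat tensm_r !compA.
rewrite (compE _ (tensm_lr c k)) -(compE _ (tensm_rl c k)).
by rewrite -tensm1 (compE2 _ (assoc_nat M (idm X) (idm Y) k)).
Qed.

Lemma Lm_ev X Y1 Y Y' (f : mor Y1 Y) (v : mor (Y ⊗ X) I)
    (c : mor I (X ⊗ Y')) :
  Lm (v ∘ (f ⊠ idm X)) c = Lm v c ∘ f.
Proof.
rewrite /Lm -[RHS]compA runitV_nat tensm_l !compA.
rewrite (compE _ (tensm_rl f c)) -(compE _ (tensm_lr f c)).
by rewrite -tensm1 (compE2 _ (assocV_nat f (idm X) (idm Y'))).
Qed.

Lemma Lm_coev X Y Y' Y2 (v : mor (Y ⊗ X) I) (c : mor I (X ⊗ Y'))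
    (g : mor Y' Y2) :
  Lm v ((idm X ⊠ g) ∘ c) = g ∘ Lm v c.
Proof.
rewrite /Lm tensm_r !compA (compE2 _ (assocV_nat (idm Y) (idm X) g)) tensm1.
rewrite (compE _ (tensm_lr v g)) -(compE _ (tensm_rl v g)).
by rewrite lunit_nat.
Qed.

Lemma Lm_mid X X' Y Y' (f : mor X X') (v : mor (Y ⊗ X') I)
    (c : mor I (X ⊗ Y')) :
  Lm v ((f ⊠ idm Y') ∘ c) = Lm (v ∘ (idm Y ⊠ f)) c.
Proof.
rewrite /Lm tensm_l tensm_r !compA.
by rewrite (compE2 _ (assocV_nat (idm Y) f (idm Y'))).
Qed.

(** Both sides contract the same string [v], [c], [v'], from the left or from the right: the
    pentagon compares the bracketings, and [lunit_runit] the two ways of removing the unit. For a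
    duality this characterises transposes. *)
Lemma Lm_Rm X Y Y' Z (v : mor (Y ⊗ X) I) (c : mor I (X ⊗ Y'))
    (v' : mor (Y' ⊗ Z) I) :
  v' ∘ (Lm v c ⊠ idm Z) = v ∘ (idm Y ⊠ Rm c v').
Proof.
have h : is_iso (tensm M (ρ Y) (idm Z)).
  by apply: tens_iso; [exact: runit_iso | exact: iso_id].
apply: (iso_epi h).
have -> : v' ∘ (Lm v c ⊠ idm Z) ∘ (ρ Y ⊠ idm Z)
  = v' ∘ (λ Y' ⊠ idm Z) ∘ (v ⊠ idm Y' ⊠ idm Z)
      ∘ ((assocV M Y X Y' ∘ (idm Y ⊠ c)) ⊠ idm Z).
  rewrite (compE _ (esym (tensm_l _ _ _))) /Lm -(compA _ (runitV Y)) isoVK.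
  by rewrite compm1 !tensm_l !compA.
rewrite -triangle -lunit_tens.
have -> : v ∘ (idm Y ⊠ Rm c v') ∘ ((idm Y ⊠ λ Z) ∘ α Y I Z)
  = v ∘ (idm Y ⊠ ρ X) ∘ (idm Y ⊠ (idm X ⊠ v')) ∘ (idm Y ⊠ α X Y' Z)
      ∘ α Y (X ⊗ Y') Z ∘ (idm Y ⊠ c ⊠ idm Z).
  rewrite compA (compE _ (esym (tensm_r _ _ _))) /Rm -(compA _ (lunitV Z)).
  rewrite isoVK compm1 !tensm_r !compA -!compA; congr (_ ∘ (_ ∘ (_ ∘ (_ ∘ _)))).
  by rewrite assoc_nat.
have -> : idm Y ⊠ c ⊠ idm Z
  = (α Y X Y' ⊠ idm Z) ∘ ((assocV M Y X Y' ∘ (idm Y ⊠ c)) ⊠ idm Z)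
  :> mor (Y ⊗ I ⊗ Z) _.
  by rewrite -tensm_l compA assocVK comp1m.
rewrite !compA; congr (_ ∘ _).
rewrite -[in RHS](compA _ _ (α Y X Y' ⊠ idm Z)).
rewrite -[in RHS](compA _ (idm Y ⊠ α X Y' Z)) (compA (idm Y ⊠ α _ _ _)).
rewrite pentagon.
rewrite (compE2 _ (assoc_nat M v (idm Y') (idm Z))) tensm1.
rewrite !compA; congr (_ ∘ _).
rewrite -(compE2 _ (assoc_nat M (idm Y) (idm X) v')).
rewrite (compE _ (runit_tens Y X)) tensm1 -runit_nat -lunit_nat lunit_runit.
by rewrite -!(compA (ρ I)) tensm_lr tensm_rl.
Qed.

End Monoidal.
Section MonoidalZigzag.
Variables (C : preadditive) (M : symMonoidal C).
Implicit Types X Y Z : C.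

Lemma Rm_conj X X' Y0 Y Y' Z Z' (f : mor X X') (g : mor Y0 Y') (h : mor Y' Y)
    (k : mor Z' Z) (c : mor (tunit M) (tens M X Y0))
    (v : mor (tens M Y Z) (tunit M)) :
  Rm (tensm M f g ∘ c) (v ∘ tensm M h k)
  = f ∘ Rm c (v ∘ tensm M (h ∘ g) (idm Z)) ∘ k.
Proof.
rewrite -(tensm_lr M h k) compA Rm_ev -(tensm_lr M f g) -(compA _ _ c) Rm_coev.
by rewrite Rm_dual -(compA v) -tensm_l.
Qed.

Lemma Lm_conj X0 X X' Y Y' Z Z' (f : mor X0 X') (g : mor Z Z') (h : mor Y' Y)
    (k : mor X' X) (c : mor (tunit M) (tens M X0 Z))
    (v : mor (tens M Y X) (tunit M)) :
  Lm (v ∘ tensm M h k) (tensm M f g ∘ c)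
  = g ∘ Lm (v ∘ tensm M (idm Y) (k ∘ f)) c ∘ h.
Proof.
rewrite -(tensm_rl M h k) compA Lm_ev -(tensm_rl M f g) -(compA _ _ c) Lm_coev.
by rewrite Lm_mid -(compA v) -tensm_r.
Qed.

Lemma Rm_sum X Y Z (I : finType) (c : I -> mor (tunit M) (tens M X Y))
    (v : mor (tens M Y Z) (tunit M)) :
  Rm (\sum_k c k) v = \sum_k Rm (c k) v.
Proof.
exact: (big_morph (fun c => Rm c v) (fun c c' => RmD c c' v) (Rm0 _ v)).
Qed.

Lemma Rm_sumr X Y Z (I : finType) (c : mor (tunit M) (tens M X Y))
    (v : I -> mor (tens M Y Z) (tunit M)) :
  Rm c (\sum_k v k) = \sum_k Rm c (v k).
Proof. exact: (big_morph (Rm c) (Rm_mDr c) (Rm_m0 _ c)). Qed.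

Lemma Lm_suml X Y Z (I : finType) (v : I -> mor (tens M Y X) (tunit M))
    (c : mor (tunit M) (tens M X Z)) :
  Lm (\sum_k v k) c = \sum_k Lm (v k) c.
Proof.
exact: (big_morph (fun v => Lm v c) (fun v v' => LmD v v' c) (Lm0 _ c)).
Qed.

Lemma LmDr X Y Z (v : mor (tens M Y X) (tunit M))
    (c c' : mor (tunit M) (tens M X Z)) :
  Lm v (c + c') = Lm v c + Lm v c'.
Proof. by rewrite /Lm tensmDr compDr !compDl. Qed.

Lemma Lm_m0 X Y Z (v : mor (tens M Y X) (tunit M)) :
  Lm v (0 : mor (tunit M) (tens M X Z)) = 0.
Proof. by rewrite /Lm tensm0 compm0 !comp0m. Qed.

Lemma Lm_sumr X Y Z (I : finType) (v : mor (tens M Y X) (tunit M))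
    (c : I -> mor (tunit M) (tens M X Z)) :
  Lm v (\sum_k c k) = \sum_k Lm v (c k).
Proof. exact: (big_morph (Lm v) (LmDr v) (Lm_m0 _ v)). Qed.

Lemma Rm_iso X Y Z (c : mor (tunit M) (tens M X Y))
    (v : mor (tens M Y Z) (tunit M)) :
  is_iso c -> is_iso v -> is_iso (Rm c v).
Proof.
move=> hc hv; rewrite /Rm.
apply: iso_comp; last exact: isoV_iso.
apply: iso_comp; last by apply: tens_iso => //; exact: iso_id.
apply: iso_comp; last exact: assoc_iso.
apply: iso_comp; first exact: runit_iso.
by apply: tens_iso => //; exact: iso_id.
Qed.

Lemma Lm_iso X Y Z (v : mor (tens M Y X) (tunit M))
    (c : mor (tunit M) (tens M X Z)) :
  is_iso c -> is_iso v -> is_iso (Lm v c).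
Proof.
move=> hc hv; rewrite /Lm.
apply: iso_comp; last exact: isoV_iso.
apply: iso_comp; last by apply: tens_iso => //; exact: iso_id.
apply: iso_comp; last by exists (assoc M Y X Z); rewrite ?assocK ?assocVK.
apply: iso_comp; first exact: lunit_iso.
by apply: tens_iso => //; exact: iso_id.
Qed.

End MonoidalZigzag.

(** Dualisability is mere inhabitation; over a finite index type a whole family of dualities is
    still obtained by induction, without a choice axiom. *)
Lemma finite_choice (I : finType) (D : I -> Type) :
  (forall k, inhabited (D k)) -> inhabited (forall k, D k).
Proof.
move=> hD; suff [f] : inhabited (forall k, k \in enum I -> D k).
  by constructor=> k; apply: f; rewrite mem_enum.
elim: (enum I) => [|a s [f]]; first by constructor.
have [d] := hD a; constructor=> k; rewrite inE.
by case: eqP => [->|_] // /f.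
Qed.

(** * Dualisable objects *)

Section Dualisable.
Variable T : tensorTriangulated.
Implicit Types A B X Y : T.
Local Notation M := (mon T).
Local Notation I := (tunit (mon T)).

Lemma duality_Rm A (D : duality A) :
  Rm (coev D : mor I (tens M A _)) (ev D) = idm A.
Proof. by rewrite /Rm; move: (zigzag D) => /= ->; exact: isoKV. Qed.

Lemma duality_Lm A (D : duality A) :
  Lm (ev D : mor (tens M _ A) I) (coev D) = idm (dualobj D).
Proof. by rewrite /Lm; move: (zigzag_dual D) => /= ->; exact: isoKV. Qed.

Lemma zigzag_Rm A B (c : mor I (tens M A B)) (v : mor (tens M B A) I) :
  Rm c v = idm A ->
  runit M A ∘ tensm M (idm A) v ∘ assoc M A B A ∘ tensm M c (idm A)
  = lunit M A.
Proof.
move=> /(congr1 (fun f => f ∘ lunit M A)).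
by rewrite /Rm -(compA _ (lunitV M A)) isoVK compm1 comp1m.
Qed.

Lemma zigzag_Lm A B (c : mor I (tens M A B)) (v : mor (tens M B A) I) :
  Lm v c = idm B ->
  lunit M B ∘ tensm M v (idm B) ∘ assocV M B A B ∘ tensm M (idm B) c
  = runit M B.
Proof.
move=> /(congr1 (fun f => f ∘ runit M B)).
by rewrite /Lm -(compA _ (runitV M B)) isoVK compm1 comp1m.
Qed.

Definition zigzag_duality A B (c : mor I (tens M A B))
    (v : mor (tens M B A) I) (hR : Rm c v = idm A) (hL : Lm v c = idm B) :
  duality A := @Duality T A B c v (zigzag_Rm hR) (zigzag_Lm hL).

Lemma dualisable_zigzag A B (c : mor I (tens M A B)) (v : mor (tens M B A) I) :
  Rm c v = idm A -> Lm v c = idm B -> dualisable A.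
Proof. by move=> hR hL; constructor; exact: zigzag_duality hR hL. Qed.

(* If the first zigzag is the identity, the second is idempotent. *)
Lemma dualisable_zigzag_iso A B (c : mor I (tens M A B))
    (v : mor (tens M B A) I) :
  Rm c v = idm A -> is_iso (Lm v c) -> dualisable A.
Proof.
move=> hR hL; apply: (dualisable_zigzag hR); apply: (iso_mono hL).
by rewrite -Lm_ev Lm_Rm hR tensm1 !compm1.
Qed.

(** The zigzag of [c] with its braided inverse is invertible but need not be the identity;
    precomposing the evaluation with the inverse of that zigzag repairs the first equation. *)
Lemma dualisable_invertible A B (c : mor I (tens M A B)) :
  is_iso c -> dualisable A.
Proof.
move=> hc; pose v := isoV hc ∘ braid M B A.
have hv : is_iso v by apply: iso_comp; [exact: isoV_iso | exact: braid_iso].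
have hz : is_iso (Rm c v) by exact: Rm_iso.
apply: (@dualisable_zigzag_iso A B c (v ∘ tensm M (idm B) (isoV hz))).
  by rewrite Rm_ev isoKV.
apply: Lm_iso => //; apply: iso_comp => //.
by apply: tens_iso; [exact: iso_id | exact: isoV_iso].
Qed.

(* The dual of the image of e is the image of the transpose e' of e. *)
Lemma dualisable_retract A B (j : mor A B) (q : mor B A) :
  has_countable_coproducts T -> j ∘ q = idm B -> dualisable A -> dualisable B.
Proof.
move=> hcop jq [D]; set e := q ∘ j.
have ee : e ∘ e = e by rewrite /e compA -(compA q) jq compm1.
pose c : mor I (tens M A (dualobj D)) := coev D.
pose v : mor (tens M (dualobj D) A) I := ev D.
pose e' := Lm (v ∘ tensm M (idm _) e) c.
have ve' : v ∘ tensm M e' (idm A) = v ∘ tensm M (idm _) e.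
  by rewrite /e' Lm_Rm duality_Rm tensm1 compm1.
have e'e' : e' ∘ e' = e'.
  rewrite /e' -Lm_ev -/e'; congr (Lm _ c).
  rewrite -compA tensm_rl -tensm_lr compA ve' -compA -tensmM.
  by rewrite comp1m ee.
have [B' [j' [q' [jq' qj']]]] := idempotent_split hcop e'e'.
apply: (@dualisable_zigzag B B' (tensm M j j' ∘ c) (v ∘ tensm M q' q)).
  rewrite Rm_conj qj' ve' Rm_ev duality_Rm comp1m /e.
  by rewrite !compA jq comp1m jq.
rewrite Lm_conj -/e -/e' -qj' !compA.
by rewrite jq' comp1m jq'.
Qed.

Lemma dualisable_sim A B :
  has_countable_coproducts T -> sim A B -> dualisable A -> dualisable B.
Proof.
by move=> hcop [f hf]; apply: (dualisable_retract (j := f) hcop (isoKV hf)).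
Qed.

Lemma dualisable_biproduct (J : finType) (X : J -> T) P
    (i : forall k, mor (X k) P) (p : forall k, mor P (X k)) :
  fam_biproduct i p -> (forall k, dualisable (X k)) -> dualisable P.
Proof.
move=> [pi1 pi0 ip] /finite_choice [D].
have [P' [i' [p' [pi1' pi0' ip']]]] :=
  fam_biproduct_exists (fun k => dualobj (D k)).
pose c k : mor I (tens M (X k) (dualobj (D k))) := coev (D k).
pose v k : mor (tens M (dualobj (D k)) (X k)) I := ev (D k).
pose cP : mor I (tens M P P') := \sum_k (tensm M (i k) (i' k) ∘ c k).
pose vP : mor (tens M P' P) I := \sum_k (v k ∘ tensm M (p' k) (p k)).
apply: (@dualisable_zigzag P P' cP vP).
  rewrite Rm_sum -ip; apply: eq_bigr => k _; rewrite Rm_sumr (bigD1 k) //=.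
  rewrite Rm_conj pi1' tensm1 compm1 duality_Rm compm1 big1 ?addr0 // => l lk.
  by rewrite Rm_conj pi0' // tens0m compm0 Rm_m0 compm0 comp0m.
rewrite Lm_sumr -ip'; apply: eq_bigr => k _; rewrite Lm_suml (bigD1 k) //=.
rewrite Lm_conj pi1 tensm1 compm1 duality_Lm compm1 big1 ?addr0 // => l lk.
by rewrite Lm_conj pi0 // tensm0 compm0 Lm0 compm0 comp0m.
Qed.

End Dualisable.

(** * Shifts and the tensor product *)

Section ShiftTensor.
Variable T : tensorTriangulated.
Implicit Types A B X Y : T.
Local Notation M := (mon T).
Local Notation I := (tunit (mon T)).

Lemma tens_sim A A' B B' : sim A A' -> sim B B' -> sim (tens M A B) (tens M A' B').
Proof. by move=> [f hf] [g hg]; exists (tensm M f g); exact: tens_iso. Qed.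

Lemma sh_sim_eq m n k X : m + n = k -> sim (sh n (sh m X)) (sh k X).
Proof. by move=> <-; exact: shD_sim. Qed.

Lemma unsh_sim m n X : m + n = 0 -> sim (sh n (sh m X)) X.
Proof. by move=> h; exists (unsh h X); exact: unsh_iso. Qed.

Lemma tens_sh_sim_nat (n : nat) X Y :
  sim (tens M (sh n X) Y) (sh n (tens M X Y)).
Proof.
elim: n => [|n IH].
  apply: sim_trans (sim_sym (sh0_sim _)).
  by apply: tens_sim; [exact: sh0_sim | exact: simxx].
have e : n%:Z + 1 = n.+1%:Z by rewrite -PoszD addn1.
apply: sim_trans (sh_sim_eq _ e); apply: sim_trans (sh_sim 1 IH).
apply: (@sim_trans _ (tens M (sh 1 (sh n X)) Y)).
  by apply: tens_sim (simxx _); apply: sim_sym; exact: sh_sim_eq.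
by exists (tsh (sh n X) Y); exact: tsh_iso.
Qed.

(** [tsh] handles the shift by one and hence all positive shifts; a negative one is reduced to these
    by shifting up and back down. *)
Lemma tens_sh_sim n X Y : sim (tens M (sh n X) Y) (sh n (tens M X Y)).
Proof.
case: n => n; first exact: tens_sh_sim_nat.
rewrite NegzE; set m := n.+1.
apply: (@sim_trans _ (sh (- m%:Z) (sh m (tens M (sh (- m%:Z) X) Y)))).
  by apply: sim_sym; apply: unsh_sim; exact: subrr.
apply: sh_sim; apply: sim_trans (sim_sym (tens_sh_sim_nat _ _ _)) _.
by apply: tens_sim (simxx _); apply: unsh_sim; exact: addNr.
Qed.

Lemma tens_unit_sh_sim n X : sim (tens M X (sh n I)) (sh n X).
Proof.
apply: (@sim_trans _ (tens M (sh n I) X)).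
  by exists (braid M X (sh n I)); exact: braid_iso.
apply: sim_trans (tens_sh_sim _ _ _) _; apply: sh_sim.
by exists (lunit M X); exact: lunit_iso.
Qed.

Lemma dualisable_unit_sh n : dualisable (sh n I : T).
Proof.
suff [c hc] : sim I (tens M (sh n I) (sh (- n) I)).
  exact: dualisable_invertible hc.
apply: sim_sym; apply: sim_trans (tens_unit_sh_sim _ _) _.
by apply: unsh_sim; exact: subrr.
Qed.

End ShiftTensor.

(** * Consequences of additivity *)

Section Traces.
Variable T : tensorTriangulated.
Hypothesis hcop : has_countable_coproducts T.
Hypothesis hadd : additivity_of_traces T.
Implicit Types A B X Y Z : T.
Local Notation M := (mon T).
Local Notation I := (tunit (mon T)).

(** Additivity is applied to zero endomorphisms, just for its claim that the cone is dualisable. *)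
Lemma dualisable_cone X Y Z (u : mor X Y) (v : mor Y Z) (w : mor Z (sh 1 X)) :
  dist u v w -> dualisable X -> dualisable Y -> dualisable Z.
Proof.
move=> huvw [DX] [DY].
have [|DZ _] := hadd (fA := 0) (fB := 0) DX DY huvw; last by constructor.
by rewrite comp0m compm0.
Qed.

(** A form of dualisability that is visibly invariant under shifts; it avoids constructing a dual
    for [X ⊗ 1[n]]. *)
Definition shift_dualisable X := forall n, dualisable (sh n X).

Lemma shift_dualisable0 X : shift_dualisable X -> dualisable X.
Proof. by move/(_ 0); apply: (dualisable_sim hcop); exact: sh0_sim. Qed.

Lemma shift_dualisable_sh n X : shift_dualisable X -> shift_dualisable (sh n X).
Proof.
by move=> hX k; apply: (dualisable_sim hcop) (hX (n + k)); apply/sim_sym/shD_sim.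
Qed.

Lemma shift_dualisable_sim X Y :
  sim X Y -> shift_dualisable X -> shift_dualisable Y.
Proof. by move=> hXY hX k; apply: (dualisable_sim hcop) (hX k); exact: sh_sim. Qed.

Lemma shift_dualisable_unit n : shift_dualisable (sh n I).
Proof.
apply: shift_dualisable_sh => k; exact: dualisable_unit_sh.
Qed.

Lemma shift_dualisable_retract X Y (j : mor X Y) (q : mor Y X) :
  j ∘ q = idm Y -> shift_dualisable X -> shift_dualisable Y.
Proof.
move=> jq hX k; apply: (dualisable_retract hcop (j := shm k j) (q := shm k q)).
  by rewrite -shmM jq shm1.
exact: hX.
Qed.

Lemma shift_dualisable_biproduct (J : finType) (X : J -> T) P
    (i : forall k, mor (X k) P) (p : forall k, mor P (X k)) :
  fam_biproduct i p -> (forall k, shift_dualisable (X k)) ->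
  shift_dualisable P.
Proof.
move=> /fam_biproduct_sh h hX n; apply: (dualisable_biproduct (h n)) => k.
exact: hX.
Qed.

Lemma shift_dualisable_zero X : is_zero_object X -> shift_dualisable X.
Proof.
move=> hX; apply: (shift_dualisable_retract (j := 0 : mor (sh 0 I) X) (q := 0)).
  by rewrite compm0 zero_object0.
exact: shift_dualisable_unit.
Qed.

(* Shifting a triangle introduces signs, tensoring it with 1[n] does not. *)
Lemma shift_dualisable_cone X Y Z (u : mor X Y) (v : mor Y Z)
    (w : mor Z (sh 1 X)) :
  dist u v w -> shift_dualisable X -> shift_dualisable Y -> shift_dualisable Z.
Proof.
move=> huvw hX hY n.
have h A := tens_unit_sh_sim n A.
apply: (dualisable_sim hcop (h Z)).
apply: (dualisable_cone (tens_exact (sh n I) huvw)).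
  by apply: (dualisable_sim hcop (sim_sym (h X))); exact: hX.
by apply: (dualisable_sim hcop (sim_sym (h Y))); exact: hY.
Qed.

Lemma trace0 A (D : duality A) : trace D 0 = 0.
Proof. by rewrite /trace tensm0 compm0 !comp0m. Qed.

Lemma traceD A (D : duality A) f g : trace D (f + g) = trace D f + trace D g.
Proof. by rewrite /trace tensmDr compDr !compDl. Qed.

Lemma trace_sum A (D : duality A) (J : finType) (f : J -> mor A A) :
  trace D (\sum_k f k) = \sum_k trace D (f k).
Proof. exact: (big_morph (trace D) (traceD D) (trace0 D)). Qed.

Lemma trace_cyclic A B (DA : duality A) (DB : duality B) (i : mor A B)
    (g r : mor B A) :
  r ∘ i = idm A -> trace DB (i ∘ g) = trace DA (g ∘ i).
Proof.
move=> ri; have [C [v [w huvw]]] := dist_cone i.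
have [|DC [fC [fCv _]]] := hadd (fA := g ∘ i) (fB := i ∘ g) DA DB huvw.
  by rewrite compA.
(* [fC ∘ v = v ∘ i ∘ g = 0], and [v] is an epimorphism because [i] splits. *)
have -> : fC = 0.
  apply: (split_mono_epi huvw ri).
  by rewrite fCv compA (dist_comp0 huvw) !comp0m.
by rewrite trace0 sub0r => /eqP; rewrite addrC subr_eq0 => /eqP.
Qed.

Lemma trace_indep A (D D' : duality A) f : trace D f = trace D' f.
Proof.
have := trace_cyclic D' D (f) (comp1m (idm A)).
by rewrite comp1m compm1.
Qed.

(** In the triangle [A -> 0 -> A[1]] the last map is minus the identity, so compatibility forces the
    endomorphism supplied by additivity to be [f[1]]. *)
Lemma trace_shift A (D : duality A) (D1 : duality (sh 1 A)) f :
  trace D1 (shm 1 f) = - trace D f.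
Proof.
have [O hO] := zero_objectP T.
have [DO] := shift_dualisable0 (shift_dualisable_zero hO).
have [|DC [fC [_ e]]] :=
    hadd (fA := f) (fB := 0) D DO (dist_rot1 (dist_id A hO)).
  by rewrite !comp0m.
move: e; rewrite shm1 compmN compNm compm1 comp1m => /oppr_inj <-.
rewrite trace0 subr0 (trace_indep DC D1) => /eqP.
by rewrite addr_eq0 => /eqP.
Qed.

Lemma Rm_unit : Rm (lunitV M I) (lunit M I) = idm I.
Proof.
rewrite /Rm (compE _ (triangle M I I)) (compE _ (esym (tensm_l M _ _ _))).
by rewrite -lunit_runit isoKV tensm1 compm1 isoKV.
Qed.

Lemma Lm_unit : Lm (lunit M I) (lunitV M I) = idm I.
Proof.
have e : tensm M (lunit M I) (idm I) ∘ assocV M I I I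
  = tensm M (idm I) (lunit M I).
  apply: (iso_epi (assoc_iso M I I I)).
  by rewrite -compA assocK compm1 triangle lunit_runit.
rewrite /Lm (compE _ e) (compE _ (esym (tensm_r M _ _ _))) isoKV tensm1 compm1.
by rewrite lunit_runit isoKV.
Qed.

(** By [trace_indep] the unit may be taken as its own dual, where the braiding cancels against the
    unit isomorphisms. *)
Lemma trace_unit (D : duality (I : T)) r : trace D r = r.
Proof.
rewrite (trace_indep D (zigzag_duality Rm_unit Lm_unit)) /trace /=.
by rewrite lunit_nat (compE _ (lunit_braid M I)) -lunit_runit -compA isoKV compm1.
Qed.

Lemma trace_unit_sh n (D : duality (sh n I)) (r : mor I I) :
  trace D (shm n r) = r *~ ((-1) ^+ absz n).
Proof.
(* [sh k I] is only isomorphic to [sh 1 (sh m I)]; [trace_cyclic] carries the trace along [shD]. The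
   step is read upwards for positive and downwards for negative degrees. *)
have step m k (h : m + 1 = k) (Dm : duality (sh m I)) (Dk : duality (sh k I)) :
    trace Dk (shm k r) = - trace Dm (shm m r).
  have [D1] := @shift_dualisable_unit m 1.
  rewrite -(trace_shift Dm D1).
  have hs := shD_iso h I.
  have -> : shm k r = shD h I ∘ (shm 1 (shm m r) ∘ isoV hs).
    by rewrite compA shD_nat -compA isoKV compm1.
  by rewrite (trace_cyclic D1 Dk _ (isoVK hs)) -compA isoVK compm1.
elim/int_ind: n D => [|n IH|n IH] D.
- have [DI] := shift_dualisable0
    (shift_dualisable_sim (sh0_sim I) (@shift_dualisable_unit 0)).
  have -> : shm 0 r = sh0V I ∘ (r ∘ sh0 I).
    by rewrite compA sh0V_nat -compA sh0K compm1.
  by rewrite (trace_cyclic DI D _ (sh0VK I)) -compA sh0VK compm1 trace_unit.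
- have [Dn] := @dualisable_unit_sh T n.
  have h : n%:Z + 1 = n.+1%:Z by rewrite -PoszD addn1.
  rewrite (step _ _ h Dn D) IH; by rewrite /= exprS mulN1r mulrNz.
- have [Dn] := @dualisable_unit_sh T (- n%:Z).
  have h : - (n.+1%:Z) + 1 = - n%:Z by rewrite -addn1 PoszD opprD addrNK.
  rewrite -[LHS]opprK -(step _ _ h D Dn) IH.
  by rewrite !abszN /= exprS mulN1r mulrNz.
Qed.

End Traces.

(** * Graded modules and graded morphism groups *)

Section GradedHoms.
Variable R : gradedRing.
Implicit Types M N P : gradedModule R.

Lemma ghom0 M N (f : ghom M N) m : f m 0 = 0.
Proof. by apply: (@addrI _ (f m 0)); rewrite -ghomD !addr0. Qed.

Lemma ghomN M N (f : ghom M N) m x : f m (- x) = - f m x.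
Proof. by apply/eqP; rewrite -addr_eq0 -ghomD addNr ghom0. Qed.

Lemma ghomB M N (f : ghom M N) m x y : f m (x - y) = f m x - f m y.
Proof. by rewrite ghomD ghomN. Qed.

Lemma ghom_sum M N (f : ghom M N) m J (r : seq J) (Q : pred J) (F : J -> M m) :
  f m (\sum_(k <- r | Q k) F k) = \sum_(k <- r | Q k) f m (F k).
Proof. exact: (big_morph (f m) (@ghomD _ _ _ f m) (ghom0 f m)). Qed.

Fact ghom_compD M N P (g : ghom N P) (f : ghom M N) m (x y : M m) :
  g m (f m (x + y)) = g m (f m x) + g m (f m y).
Proof. by rewrite !ghomD. Qed.

Fact ghom_compZ M N P (g : ghom N P) (f : ghom M N) (m n k : int)
    (h : m + n = k) (x : M m) (r : R n) :
  g k (f k (gact h x r)) = gact h (g m (f m x)) r.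
Proof. by rewrite !ghomZ. Qed.

Definition ghom_comp M N P (g : ghom N P) (f : ghom M N) : ghom M P :=
  GHom (ghom_compD g f) (ghom_compZ g f).

Definition ghom_id M : ghom M M :=
  @GHom R M M (fun m x => x) (fun m x y => erefl) (fun m n k h x r => erefl).

(** Preimages are chosen elementwise in a choice type; injectivity of [i] makes the selection
    additive and linear. *)
Lemma ghom_factor M N P (i : ghom M N) (f : ghom P N) :
  (forall m x, i m x = 0 -> x = 0) ->
  (forall m x, exists y, i m y = f m x) ->
  exists g : ghom P M, forall m x, i m (g m x) = f m x.
Proof.
move=> inj fac.
have ex m x : exists y, i m y == f m x by have [y <-] := fac m x; exists y.
pose g m x := xchoose (ex m x).
have gP m x : i m (g m x) = f m x by apply/eqP; exact: (xchooseP (ex m x)).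
have inj' m x y : i m x = i m y -> x = y.
  by move=> e; apply/eqP; rewrite -subr_eq0; apply/eqP/inj; rewrite ghomB e subrr.
have gD m x y : g m (x + y) = g m x + g m y.
  by apply: inj'; rewrite ghomD !gP ghomD.
have gZ m n k (h : m + n = k) x r : g k (gact h x r) = gact h (g m x) r.
  by apply: inj'; rewrite ghomZ !gP ghomZ.
by exists (GHom gD gZ).
Qed.

Lemma ghom_bij_inv M N (f : ghom M N) :
  (forall m x, f m x = 0 -> x = 0) -> gsurjective f ->
  exists2 g : ghom N M, forall m x, g m (f m x) = x & forall m y, f m (g m y) = y.
Proof.
move=> inj surj; have [g gP] := ghom_factor (f := ghom_id N) inj surj.
exists g => // m x; apply/eqP; rewrite -subr_eq0; apply/eqP/inj.
by rewrite ghomB gP subrr.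
Qed.

End GradedHoms.

(** * Full faithfulness of the graded morphism functor *)

Section GradedHomFunctor.
Variables (C : shiftCategory) (U : C).
Implicit Types A B X L : C.

Fact gHom_morD A B (f : mor A B) m (x y : homn m U A) :
  shm m f ∘ (x + y) = shm m f ∘ x + shm m f ∘ y.
Proof. exact: compDr. Qed.

Fact gHom_morZ A B (f : mor A B) (m n k : int) (h : m + n = k)
    (x : homn m U A) (r : homn n U U) :
  shm k f ∘ compn h x r = compn h (shm m f ∘ x) r.
Proof. by rewrite /compn shmM !compA shD_nat. Qed.

Definition gHom_mor A B (f : mor A B) : ghom (gHom U A) (gHom U B) :=
  @GHom _ (gHom U A) (gHom U B) (fun m x => shm m f ∘ x)
    (@gHom_morD A B f) (@gHom_morZ A B f).

(** The target is arbitrary: this is what turns an augmentation into a morphism to [A], on which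
    nothing comparable is known. *)
Definition gHom_full B := forall X (phi : ghom (gHom U B) (gHom U X)),
  exists f : mor B X, forall m x, phi m x = shm m f ∘ x.

Definition gHom_faithful B := forall X (f : mor B X),
  (forall m (x : homn m U B), shm m f ∘ x = 0) -> f = 0.

Lemma gHom_faithful_eq B X (f g : mor B X) : gHom_faithful B ->
  (forall m (x : homn m U B), shm m f ∘ x = shm m g ∘ x) -> f = g.
Proof.
move=> hB e; apply/eqP; rewrite -subr_eq0; apply/eqP/hB => m x.
by rewrite shmD shmN compBl e subrr.
Qed.

Section ShiftedUnit.
Variable n : int.

(** The free generator, in degree [-n], of the module of [U[n]]. As in the Yoneda lemma, a module
    map is determined by its value here, and any value is realised. *)
Definition unit_gen : homn (- n) U (sh n U) := isoV (unsh_iso (subrr n) U).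

Lemma unit_gen_iso : is_iso unit_gen.
Proof. exact: isoV_iso. Qed.

Lemma unit_genP m (x : homn m U (sh n U)) :
  exists r : homn (n + m) U U, x = compn (addKr n m) unit_gen r.
Proof.
have h : is_iso (shD (addKr n m) (sh n U) ∘ shm (n + m) unit_gen).
  by apply: iso_comp; [exact: shD_iso | apply: shm_iso; exact: unit_gen_iso].
by exists (isoV h ∘ x); rewrite /compn !compA isoKV comp1m.
Qed.

Lemma gHom_full_unit : gHom_full (sh n U).
Proof.
move=> X phi; have [f hf] := shm_full (phi (- n) unit_gen ∘ unsh (subrr n) U).
exists f => m x; have [r ->] := unit_genP x.
rewrite gHom_morZ hf -compA isoKV compm1.
exact: (@ghomZ _ _ _ phi).
Qed.

Lemma gHom_faithful_unit : gHom_faithful (sh n U).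
Proof.
move=> X f /(_ _ unit_gen) e; apply: (@shm_inj _ (- n)).
by apply: (iso_epi unit_gen_iso); rewrite e shm0 comp0m.
Qed.

End ShiftedUnit.

Section Biproduct.
Variables (J : finType) (X : J -> C) (P : C).
Variables (i : forall k, mor (X k) P) (p : forall k, mor P (X k)).
Hypothesis ip : fam_biproduct i p.

Lemma biproduct_sum m (x : homn m U P) :
  x = \sum_k shm m (i k) ∘ (shm m (p k) ∘ x).
Proof.
case: ip => _ _ e; rewrite -[LHS]comp1m -shm1 -e shm_sum comp_suml.
by apply: eq_bigr => k _; rewrite shmM compA.
Qed.

Lemma gHom_full_biproduct : (forall k, gHom_full (X k)) -> gHom_full P.
Proof.
move=> hX Y phi.
have [f hf] : exists f : forall k, mor (X k) Y,
    forall k m x, phi m (shm m (i k) ∘ x) = shm m (f k) ∘ x.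
  have /finite_choice [F] : forall k, inhabited {f : mor (X k) Y |
      forall m x, phi m (shm m (i k) ∘ x) = shm m f ∘ x}.
    move=> k; have [f hf] := hX k _ (ghom_comp phi (gHom_mor (i k))).
    by constructor; exists f.
  by exists (fun k => sval (F k)) => k; exact: (svalP (F k)).
exists (\sum_k f k ∘ p k) => m x.
rewrite {1}[x]biproduct_sum (ghom_sum phi) shm_sum comp_suml.
by apply: eq_bigr => k _; rewrite hf shmM compA.
Qed.

Lemma gHom_faithful_biproduct :
  (forall k, gHom_faithful (X k)) -> gHom_faithful P.
Proof.
move=> hX Y f hf; case: ip => _ _ e.
rewrite -[f]compm1 -e comp_sumr big1 // => k _; rewrite compA.
suff -> : f ∘ i k = 0 by rewrite comp0m.
by apply: hX => m x; rewrite shmM -compA hf.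
Qed.

End Biproduct.

Lemma gHom_full_retract A B (j : mor A B) (q : mor B A) :
  j ∘ q = idm B -> gHom_full A -> gHom_full B.
Proof.
move=> jq hA X phi; have [f hf] := hA _ (ghom_comp phi (gHom_mor j)).
exists (f ∘ q) => m x.
by rewrite shmM -compA -hf /= compA -shmM jq shm1 comp1m.
Qed.

Lemma gHom_faithful_retract A B (j : mor A B) (q : mor B A) :
  j ∘ q = idm B -> gHom_faithful A -> gHom_faithful B.
Proof.
move=> jq hA X f hf; rewrite -[f]compm1 -jq compA.
suff -> : f ∘ j = 0 by rewrite comp0m.
by apply: hA => m x; rewrite shmM -compA hf.
Qed.

(** * Sums of shifts of the unit and free modules *)

Section Free.
Variables (r : nat) (ns : 'I_r -> int) (L : C).
Variables (i : forall k, mor (sh (ns k) U) L).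
Variables (p : forall k, mor L (sh (ns k) U)).
Hypothesis ip : fam_biproduct i p.

Definition to_free_fun m (x : homn m U L) : gfree (gEnd U) ns m :=
  [ffun k => (shD erefl U ∘ (shm m (p k) ∘ x) : homn (ns k + m) U U)].

Fact to_freeD m (x y : homn m U L) :
  to_free_fun (x + y) = to_free_fun x + to_free_fun y.
Proof. by apply/ffunP => k; rewrite !ffunE !compDr. Qed.

Fact to_freeZ (m n k : int) (h : m + n = k) (x : homn m U L) (s : homn n U U) :
  to_free_fun (compn h x s)
  = @gact _ (gfree (gEnd U) ns) m n k h (to_free_fun x) s.
Proof.
apply/ffunP => l; rewrite !ffunE gHom_morZ /= /gshift_act /= /compn.
by rewrite !shmM !compA (shDA erefl h (gshift_idx (ns l) h) erefl).
Qed.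

Definition to_free : ghom (gHom U L) (gfree (gEnd U) ns) :=
  @GHom _ (gHom U L) (gfree (gEnd U) ns) to_free_fun to_freeD to_freeZ.

Lemma to_free_inj m x : to_free m x = 0 -> x = 0.
Proof.
move=> /ffunP e; rewrite [x](biproduct_sum ip) big1 // => k _.
suff -> : shm m (p k) ∘ x = 0 by rewrite compm0.
apply: (iso_mono (shD_iso (erefl (ns k + m)) U)).
by move: (e k); rewrite !ffunE compm0.
Qed.

Lemma to_free_surj : gsurjective to_free.
Proof.
move=> m y.
exists (\sum_k shm m (i k) ∘ (isoV (shD_iso (erefl (ns k + m)) U) ∘ y k)).
case: ip => pi1 pi0 _; apply/ffunP => k; rewrite !ffunE.
rewrite !comp_sumr (bigD1 k) //= big1 => [|l lk].
  by rewrite addr0 (compA (shm _ _)) -shmM pi1 shm1 comp1m compA isoKV comp1m.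
by rewrite (compA (shm _ _)) -shmM pi0 1?eq_sym // shm0 comp0m compm0.
Qed.

(** Stated for an arbitrary equality of degrees, which can be eliminated, unlike [subrr (ns k)]. *)
Lemma gcast_sh (a b : int) (h : a = b) (s : mor U U) (e : homn b U U) :
  gcast (R := gEnd U) h (shm a s ∘ gcast (R := gEnd U) (esym h) e) = shm b s ∘ e.
Proof. by case: b / h e. Qed.

(** Under [to_free], the generator of the [k]-th summand comes from that summand through [i k], so
    the diagonal entry only sees [p k ∘ f ∘ i k]. *)
Lemma diag_entry_sh (f : mor L L)
    (Phi : ghom (gfree (gEnd U) ns) (gfree (gEnd U) ns)) k (s : mor U U) :
  (forall m x, Phi m (to_free m x) = to_free m (shm m f ∘ x)) ->
  shm (ns k) s = p k ∘ f ∘ i k ->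
  diag_entry Phi k = sh0V U ∘ s.
Proof.
move=> hPhi hs; rewrite /diag_entry sh0V_nat -(gcast_sh (subrr (ns k))).
congr gcast; move: (gcast _ _) => e.
have [x hx] := to_free_surj (gfree_in e).
have hD := shD_iso (erefl (ns k - ns k)) U.
have xE : x = shm _ (i k) ∘ (isoV hD ∘ e).
  rewrite [LHS](biproduct_sum ip) (bigD1 k) //= big1 => [|l lk].
    rewrite addr0; congr (_ ∘ _); apply: (iso_mono hD).
    rewrite !compA isoKV comp1m.
    by move/ffunP/(_ k): hx; rewrite !ffunE dfwith_in compA.
  rewrite [X in _ ∘ X](_ : _ = 0) ?compm0 //.
  apply: (iso_mono (shD_iso (erefl (ns l - ns k)) U)); rewrite compm0.
  by move/ffunP/(_ l): hx; rewrite !ffunE dfwith_out 1?eq_sym.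
rewrite -hx hPhi !ffunE xE.
rewrite !compA -(compA (shD _ _)) -shmM -(compA (shD _ _)) -shmM -hs.
by rewrite shD_nat -(compA _ (shD _ _)) isoKV compm1.
Qed.

End Free.

End GradedHomFunctor.

Section GradedModuleConstructions.
Variable R : gradedRing.
Implicit Types M N P Q : gradedModule R.

Definition ghom_zero M N : ghom M N.
Proof.
exists (fun m _ => 0) => [m x y|m n k h x r]; first by rewrite addr0.
by apply: (@addrI _ (gact h 0 r)); rewrite -gactDl !addr0.
Defined.

Definition ghom_add M N (f g : ghom M N) : ghom M N.
Proof.
exists (fun m x => f m x + g m x) => [m x y|m n k h x r].
  by rewrite !ghomD addrACA.
by rewrite !ghomZ gactDl.
Defined.

Definition ghom_fst P Q : ghom (gsum P Q) P.
Proof. by exists (fun m (x : gsum P Q m) => x.1). Defined.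

Definition ghom_snd P Q : ghom (gsum P Q) Q.
Proof. by exists (fun m (x : gsum P Q m) => x.2). Defined.

Definition ghom_pair M P Q (f : ghom M P) (g : ghom M Q) : ghom M (gsum P Q).
Proof.
exists (fun m x => (f m x, g m x) : gsum P Q m) => [m x y|m n k h x r].
  by rewrite !ghomD.
by rewrite !ghomZ.
Defined.

Definition ghom_shift n M N (f : ghom M N) : ghom (gshift n M) (gshift n N).
Proof.
exists (fun m (x : gshift n M m) => f (n + m) x : gshift n N m).
  by move=> m x y; exact: (@ghomD _ _ _ f).
by move=> m k l h x r; exact: (@ghomZ _ _ _ f).
Defined.

Lemma gact_suml M (m n k : int) (h : m + n = k) J (s : seq J) (Q : pred J)
    (F : J -> M m) (r : R n) :
  gact h (\sum_(j <- s | Q j) F j) r = \sum_(j <- s | Q j) gact h (F j) r.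
Proof.
apply: (big_morph (fun x => gact h x r) (fun x y => gactDl h x y r)).
by apply: (@addrI _ (gact h 0 r)); rewrite -gactDl !addr0.
Qed.

Lemma gact_cast M (a b c m : int) (h : a + b = m) (h' : a + c = m) (e : b = c)
    (x : M a) (r : R b) :
  gact h x r = gact h' x (gcast e r).
Proof. by case: c / e h' => h'; rewrite (eq_irrelevance h h'). Qed.

Lemma finitely_generated_quotient P : finitely_generated P ->
  exists (r : nat) (ns : 'I_r -> int) (f : ghom (gfree R ns) P), gsurjective f.
Proof.
(* [R[n]] has its generator in degree [-n], whence the sign. *)
move=> [r [k [e he]]]; pose ns i := - k i.
pose f m (y : gfree R ns m) : P m := \sum_i gact (addNKr (k i) m) (e i) (y i).
have fD m (x y : gfree R ns m) : f m (x + y) = f m x + f m y.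
  by rewrite -big_split; apply: eq_bigr => i _; rewrite !ffunE gactDr.
have fZ m n l (h : m + n = l) (x : gfree R ns m) (s : R n) :
    f l (gact h x s) = gact h (f m x) s.
  rewrite gact_suml; apply: eq_bigr => i _; rewrite !ffunE.
  exact: gactA.
exists r, ns, (GHom fD fZ) => m x; have [c ->] := he m x.
exists [ffun i => gcast (addrC m (- k i)) (c i) : R (ns i + m)].
apply: eq_bigr => i _; rewrite ffunE; symmetry; exact: gact_cast.
Qed.

End GradedModuleConstructions.

(** * Objects built from the unit *)

Section Cellular.
Variables (T : triangulated) (U : T).
Implicit Types A B X Y Z : T.

Definition right_orthogonal Y X := forall n (f : homn n X Y), f = 0.

Lemma right_orthogonal_sh Y n X :
  right_orthogonal Y X -> right_orthogonal Y (sh n X).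
Proof.
move=> hX m f; apply: (@shm_inj _ (- n)); rewrite shm0.
apply: (iso_epi (isoV_iso (unsh_iso (subrr n) X))); rewrite comp0m.
apply: (iso_mono (shD_iso (erefl (m - n)) Y)); rewrite compm0.
exact: hX.
Qed.

(** Imposing the vanishing in all degrees gives stability under shifts; a morphism from a cone that
    kills [v] factors through [X[1]]. *)
Lemma right_orthogonal_localising Y : localising (right_orthogonal Y).
Proof.
split=> [X X' f hf hX n g|Z hZ n f|n X|X X' Z u v w huvw hX hX' n f|
  X P i hi hX n f].
- by apply: (iso_epi hf); rewrite comp0m; exact: hX.
- by case: (hZ (sh n Y)).
- exact: right_orthogonal_sh.
- have fv : f ∘ v = 0 by exact: hX'.
  have [g <-] := weak_cokernel (dist_rot1 huvw) fv.
  by rewrite (_ : g = 0) ?comp0m //; exact: right_orthogonal_sh.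
- by apply: (coproduct_eq hi) => k; rewrite comp0m; exact: hX.
Qed.

(* All that is used of the localising subcategory generated by U. *)
Definition cellular X :=
  forall Y, right_orthogonal Y U -> right_orthogonal Y X.

Lemma localising_cellular X : in_localising_generated_by U X -> cellular X.
Proof. by move=> h Y; apply: h; exact: right_orthogonal_localising. Qed.

Lemma cellular_cone X Y Z (u : mor X Y) (v : mor Y Z) (w : mor Z (sh 1 X)) :
  dist u v w -> cellular X -> cellular Y -> cellular Z.
Proof.
move=> huvw hX hY W hW.
exact: (loc_cone (right_orthogonal_localising W) huvw (hX _ hW) (hY _ hW)).
Qed.

Lemma cellular_unit n : cellular (sh n U).
Proof. by move=> Y hY; exact: right_orthogonal_sh. Qed.

Lemma cellular_biproduct (J : finType) (X : J -> T) P
    (i : forall k, mor (X k) P) (p : forall k, mor P (X k)) :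
  fam_biproduct i p -> (forall k, cellular (X k)) -> cellular P.
Proof.
move=> [_ _ e] hX Y hY n f; rewrite -[f]compm1 -e comp_sumr big1 // => k _.
by rewrite compA (hX k _ hY n (f ∘ i k)) comp0m.
Qed.

Lemma cellular_retract X Y (j : mor X Y) (q : mor Y X) :
  j ∘ q = idm Y -> cellular X -> cellular Y.
Proof.
move=> jq hX W hW n f.
by rewrite -[f]compm1 -jq compA (hX _ hW n (f ∘ j)) comp0m.
Qed.

(** With [X] itself as test object, the orthogonality kills the identity of [X], seen as a morphism
    to [X[0]]. *)
Lemma cellular_zero X : cellular X -> right_orthogonal X U -> is_zero_object X.
Proof.
move=> hX /hX h; apply: zero_objectE.
by apply: (iso_mono (isoV_iso (sh0_iso X))); rewrite compm0; exact: h.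
Qed.

(** Shifting the triangle would introduce signs; instead [f] is moved to a morphism from [W[-n]],
    where [weak_kernel] applies. *)
Lemma exact_sh X Y Z W (u : mor X Y) (v : mor Y Z) (w : mor Z (sh 1 X)) n
    (f : mor W (sh n Y)) :
  dist u v w -> shm n v ∘ f = 0 -> exists g : mor W (sh n X), shm n u ∘ g = f.
Proof.
move=> huvw vf; have hW := unsh_iso (addNr n) W.
have [f' hf'] := shm_full (f ∘ unsh (addNr n) W).
have vf' : v ∘ f' = 0.
  by apply: (@shm_inj _ n); rewrite shmM hf' compA vf comp0m shm0.
have [g hg] := weak_kernel huvw vf'.
exists (shm n g ∘ isoV hW).
by rewrite compA -shmM hg hf' -compA isoKV compm1.
Qed.

End Cellular.

(** * Realisation of projective modules *)

Section Realisation.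
Variable T : tensorTriangulated.
Hypothesis hcop : has_countable_coproducts T.
Hypothesis hadd : additivity_of_traces T.
Implicit Types A B X Y Z L : T.
Local Notation U := (@tt1 T).
Local Notation R := (Rgr T).

(** Everything the induction uses about the object realising [P_0]. The conditions hold for sums of
    shifts of the unit and pass to retracts. *)
Record tame B : Prop := Tame {
  tame_full : gHom_full U B;
  tame_faithful : gHom_faithful U B;
  tame_dualisable : shift_dualisable B;
  tame_cellular : cellular U B }.

Lemma tame_retract A B (j : mor A B) (q : mor B A) :
  j ∘ q = idm B -> tame A -> tame B.
Proof.
move=> jq [h1 h2 h3 h4]; split.
- exact: gHom_full_retract jq h1.
- exact: gHom_faithful_retract jq h2.
- exact: (shift_dualisable_retract hcop jq h3).
- exact: cellular_retract jq h4.
Qed.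

Lemma tame_free (r : nat) (ns : 'I_r -> int) L
    (i : forall k, mor (sh (ns k) U) L) (p : forall k, mor L (sh (ns k) U)) :
  fam_biproduct i p -> tame L.
Proof.
move=> ip; split.
- by apply: (gHom_full_biproduct ip) => k; exact: gHom_full_unit.
- by apply: (gHom_faithful_biproduct ip) => k; exact: gHom_faithful_unit.
- by apply: (shift_dualisable_biproduct ip) => k; exact: shift_dualisable_unit.
- by apply: (cellular_biproduct ip) => k; exact: cellular_unit.
Qed.

Lemma to_free_inv (r : nat) (ns : 'I_r -> int) L
    (i : forall k, mor (sh (ns k) U) L) (p : forall k, mor L (sh (ns k) U)) :
  fam_biproduct i p ->
  exists (a : ghom (Mgr L) (gfree R ns)) (aV : ghom (gfree R ns) (Mgr L)),
    [/\ forall m x, a m x = to_free p m x, forall m x, aV m (a m x) = x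
      & forall m y, a m (aV m y) = y].
Proof.
move=> ip; exists (to_free p).
have [aV aK Ka] := ghom_bij_inv (to_free_inj ip) (to_free_surj ip).
by exists aV.
Qed.

(** [P] is the image of the idempotent [s ∘ f] of a free module. Fullness on [L] realises it by some
    [e], faithfulness gives [e ∘ e = e], and [B] splits [e]. *)
Lemma realise_projective (P : gradedModule R) :
  finitely_generated P -> projective P ->
  exists (r : nat) (ns : 'I_r -> int) (L : T)
    (i : forall k, mor (sh (ns k) U) L) (p : forall k, mor L (sh (ns k) U))
    (B : T) (j : mor L B) (q : mor B L) (th : ghom P (Mgr B))
    (thV : ghom (Mgr B) P),
    [/\ fam_biproduct i p, j ∘ q = idm B, forall m x, thV m (th m x) = x
      & forall m y, th m (thV m y) = y].
Proof.
move=> /finitely_generated_quotient [r [ns [f fsurj]]] Pproj.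
have [s fs] := Pproj _ _ f (ghom_id P) fsurj.
have [L [i [p ip]]] := fam_biproduct_exists (fun k => sh (ns k) U).
have tL := tame_free ip.
have [a [aV [aE aK Ka]]] := to_free_inv ip.
have [e he] := tame_full tL (ghom_comp aV (ghom_comp s (ghom_comp f a))).
have ee : e ∘ e = e.
  apply: (gHom_faithful_eq (tame_faithful tL)) => m x.
  by rewrite shmM -compA -!he /= Ka fs.
have [B [j [q [jq qj]]]] := idempotent_split hcop ee.
exists r, ns, L, i, p, B, j, q, (ghom_comp (gHom_mor U j) (ghom_comp aV s)).
exists (ghom_comp f (ghom_comp a (gHom_mor U q))); split=> // m x /=.
  by rewrite compA -shmM qj -he /= !Ka !fs.
have -> : aV m (s m (f m (a m (shm m q ∘ x)))) = shm m (e ∘ q) ∘ x.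
  by rewrite shmM -compA -he.
by rewrite compA -shmM -qj !compA jq comp1m jq shm1 comp1m.
Qed.

Lemma to_R0D (s t : mor U U) : to_R0 (s + t) = to_R0 s + to_R0 t.
Proof. exact: compDr. Qed.

Lemma to_R0_0 : to_R0 (0 : mor U U) = 0.
Proof. exact: compm0. Qed.

Lemma to_R0_sum (J : finType) (t : J -> mor U U) :
  to_R0 (\sum_k t k) = \sum_k to_R0 (t k).
Proof. exact: (big_morph (@to_R0 T) to_R0D to_R0_0). Qed.

Lemma to_R0_sign n (t : mor U U) :
  to_R0 (t *~ (-1) ^+ n) = to_R0 t *~ (-1) ^+ n.
Proof.
rewrite -signr_odd; case: (odd n); rewrite /= ?expr0 ?expr1 ?mulr1z //.
by rewrite !mulrNz !mulr1z; exact: compmN.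
Qed.

(** Write [f] as the sum of the [i k ∘ p k ∘ f]; cyclicity turns each summand into the endomorphism
    [p k ∘ f ∘ i k] of [U[ns k]], whose trace carries the sign of the graded trace. *)
Lemma free_trace_trace (r : nat) (ns : 'I_r -> int) L
    (i : forall k, mor (sh (ns k) U) L) (p : forall k, mor L (sh (ns k) U))
    (D : duality L) (f : mor L L) (Phi : ghom (gfree R ns) (gfree R ns)) :
  fam_biproduct i p ->
  (forall m x, Phi m (to_free p m x) = to_free p m (shm m f ∘ x)) ->
  free_trace Phi = to_R0 (trace D f).
Proof.
move=> ip hPhi; have [pi1 _ e] := ip.
rewrite -[f]comp1m -e comp_suml trace_sum to_R0_sum.
apply: eq_bigr => k _.
have [s hs] := shm_full (p k ∘ f ∘ i k).
have [Dk] := @dualisable_unit_sh T (ns k).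
rewrite (diag_entry_sh ip hPhi hs) -to_R0_sign -(trace_unit_sh hcop hadd Dk) hs.
by rewrite -(compA (i k)) (trace_cyclic hadd Dk D _ (pi1 k)).
Qed.

(** Inclusion and projection of the summand [P] are realised by [q] and [j] with [j ∘ q = idm B]. As
    [Phi] vanishes on [Q], it is induced by [q ∘ f ∘ j], and cyclicity gives the trace of [f]. *)
Lemma realised_trace (P : gradedModule R) B (th : ghom P (Mgr B))
    (thV : ghom (Mgr B) P) (D : duality B) (f : mor B B) (Psi : ghom P P)
    (t : R 0) :
  tame B -> (forall m x, thV m (th m x) = x) ->
  (forall m y, th m (thV m y) = y) ->
  (forall m x, th m (Psi m x) = shm m f ∘ th m x) ->
  is_proj_trace Psi t -> t = to_R0 (trace D f).
Proof.
move=> tB thK Kth hf [Q [r [ns [phi [phiV [Phi [phiK Kphi hPhi ->]]]]]]].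
have [L [i [p ip]]] := fam_biproduct_exists (fun k => sh (ns k) U).
have tL := tame_free ip.
have [a [aV [aE aK Ka]]] := to_free_inv ip.
have [q hq] := tame_full tB (ghom_comp aV (ghom_comp phi
  (ghom_pair thV (ghom_zero (Mgr B) Q)))).
have [j hj] := tame_full tL (ghom_comp th (ghom_comp (ghom_fst P Q)
  (ghom_comp phiV a))).
have jq : j ∘ q = idm B.
  apply: (gHom_faithful_eq (tame_faithful tB)) => m x.
  by rewrite shmM -compA -hq -hj /= Ka phiK /= Kth shm1 comp1m.
have [DL] := shift_dualisable0 hcop (tame_dualisable tL).
rewrite (free_trace_trace (f := q ∘ (f ∘ j)) DL ip).
  by rewrite (trace_cyclic hadd D DL _ jq) -compA jq compm1.
move=> m x; rewrite -!aE -[in LHS](Kphi m (a m x)).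
case E: (phiV m (a m x)) => [u v]; rewrite hPhi.
rewrite !shmM -!compA -hj -hq /= Ka E /= -hf thK.
by [].
Qed.

(** The complement is taken from the category too: [C] splits [idm L - q ∘ j], so the sum of [P] and
    [M(C)] is the free module [M(L)]. *)
Lemma proj_trace_exists (P : gradedModule R) (Psi : ghom P P) :
  finitely_generated P -> projective P -> exists t, is_proj_trace Psi t.
Proof.
move=> Pfg Pproj.
have [r [ns [L [i [p [B [j [q [th [thV [ip jq thK Kth]]]]]]]]]]] :=
  realise_projective Pfg Pproj.
have [a [aV [aE aK Ka]]] := to_free_inv ip.
have [C [j' [q' [jq' qj']]]] : exists (C : T) (j' : mor L C) (q' : mor C L),
    j' ∘ q' = idm C /\ q' ∘ j' = idm L - q ∘ j.
  apply: (idempotent_split hcop).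
  rewrite compBl comp1m compBr compm1 compA -(compA q j q) jq compm1.
  by rewrite subrr subr0.
have jq'0 : j ∘ q' = 0.
  rewrite -[q']compm1 -jq' !compA -(compA j q') qj' compBr compm1 compA jq.
  by rewrite comp1m subrr comp0m.
have j'q0 : j' ∘ q = 0.
  rewrite -[j']comp1m -jq' -!compA (compA q') qj' compBl comp1m -compA jq.
  by rewrite compm1 subrr compm0.
pose phi := ghom_add
  (ghom_comp a (ghom_comp (gHom_mor U q) (ghom_comp th (ghom_fst P (Mgr C)))))
  (ghom_comp a (ghom_comp (gHom_mor U q') (ghom_snd P (Mgr C)))).
pose phiV := ghom_pair
  (ghom_comp thV (ghom_comp (gHom_mor U j) aV)) (ghom_comp (gHom_mor U j') aV).
have phiK m x : phiV m (phi m x) = x.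
  case: x => x y; rewrite /= -(ghomD a) aK !compDr !compA -!shmM.
  by rewrite jq jq'0 jq' j'q0 !shm1 !shm0 !comp1m !comp0m addr0 add0r thK.
have Kphi m y : phi m (phiV m y) = y.
  rewrite /= Kth -(ghomD a) !compA -!shmM -compDl -shmD qj'.
  by rewrite addrC subrK shm1 comp1m Ka.
pose Phi := ghom_comp phi (ghom_comp
  (ghom_pair (ghom_comp Psi (ghom_fst P (Mgr C))) (ghom_zero _ (Mgr C))) phiV).
exists (free_trace Phi), (Mgr C), r, ns, phi, phiV, Phi; split=> // m x y.
have -> : Phi m (phi m (x, y)) = phi m (Psi m (phiV m (phi m (x, y))).1, 0) by [].
by rewrite phiK.
Qed.

End Realisation.

(** * Induction on the length of the resolution *)

Section TailResolution.
Variables (R : gradedRing) (M N : gradedModule R).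
Variable P : finite_projective_resolution M.
Variable aug' : ghom (res P 1) N.
Hypothesis aug'_surj : gsurjective aug'.
Hypothesis aug'_ker : forall m y, aug' m y = 0 <-> bd P 0 m y = 0.

(** For [res_len P = 0] the predecessor truncates to 0, which is harmless: [res P j.+1] vanishes for
    all [j]. *)
Fact tail_finite j : ((res_len P).-1 < j)%N -> gzero (res P j.+1).
Proof. by move=> hj; apply: res_finite; case: (res_len P) hj. Qed.

Fact tail_exact m (y : res P 1 (1 + m)) :
  aug' _ y = 0 <-> exists x : res P 2 m, bd P 1 m x = y.
Proof. by split=> [/aug'_ker /bd_exact|/bd_exact /aug'_ker]. Qed.

Definition tail_resolution : finite_projective_resolution N :=
  @FiniteProjectiveResolution R N (res_len P).-1 (fun j => res P j.+1)
    (fun j => bd P j.+1) aug' (fun j => res_fg P j.+1)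
    (fun j => @res_proj R M P j.+1) tail_finite aug'_surj tail_exact
    (fun j => @bd_exact R M P j.+1).

End TailResolution.

Section Main.
Variable T : tensorTriangulated.
Hypothesis hcop : has_countable_coproducts T.
Hypothesis hadd : additivity_of_traces T.
Implicit Types A B C X : T.
Local Notation U := (@tt1 T).
Local Notation R := (Rgr T).

(** * The kernel of the augmentation *)

Section Step.
Variables (A B X : T) (u : mor X B) (e : mor B A) (v : mor A (sh 1 X)).
Hypothesis uev : dist u e v.
Variable P : finite_projective_resolution (Mgr A).
Variables (th : ghom (res P 0) (Mgr B)) (thV : ghom (Mgr B) (res P 0)).
Hypothesis thK : forall m x, thV m (th m x) = x.
Hypothesis Kth : forall m y, th m (thV m y) = y.
Hypothesis he : forall m x, aug P m x = shm m e ∘ th m x.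

Local Notation w := (- shm 1 u).

Fact connectingD m (x y : Mgr (sh 1 X) m) :
  shD erefl B ∘ (shm m w ∘ (x + y)) = shD erefl B ∘ (shm m w ∘ x)
    + shD erefl B ∘ (shm m w ∘ y) :> homn (1 + m) U B.
Proof. by rewrite !compDr. Qed.

Fact connectingZ (m n k : int) (h : m + n = k) (x : homn m U (sh 1 X))
    (r : homn n U U) :
  shD erefl B ∘ (shm k w ∘ compn h x r)
  = compn (gshift_idx 1 h) (shD (erefl (1 + m)) B ∘ (shm m w ∘ x)) r.
Proof.
rewrite gHom_morZ /compn.
by rewrite !shmM !compA (shDA erefl h (gshift_idx 1 h) erefl).
Qed.

Definition connecting : ghom (Mgr (sh 1 X)) (gshift 1 (Mgr B)) :=
  @GHom _ (Mgr (sh 1 X)) (gshift 1 (Mgr B))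
    (fun m x => shD erefl B ∘ (shm m w ∘ x)) connectingD connectingZ.

(** The augmentation is [M(e)], so [M(e)] is onto and the long exact sequence breaks up;
    [connecting] thereby identifies [M(X[1])] with the shifted kernel of the augmentation. *)
Lemma v_zero m (x : Mgr A m) : shm m v ∘ x = 0.
Proof.
have [y <-] := aug_surj P x.
by rewrite he compA -shmM (dist_comp0 (dist_rot1 uev)) shm0 comp0m.
Qed.

Lemma connecting_inj m x : connecting m x = 0 -> x = 0.
Proof.
move=> /= h; have {}h : shm m w ∘ x = 0.
  by apply: (iso_mono (shD_iso erefl B)); rewrite h compm0.
have [y <-] := exact_sh (dist_rot1 (dist_rot1 uev)) h.
exact: v_zero.
Qed.

Lemma connecting_image m (y : res P 0 (1 + m)) :
  aug P _ y = 0 -> exists x, connecting m x = th _ y.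
Proof.
move=> ay; have hD := shD_iso (erefl (1 + m)) B.
have h : shm m (- shm 1 e) ∘ (isoV hD ∘ th _ y) = 0.
  rewrite shmN compNm; apply/eqP; rewrite oppr_eq0; apply/eqP.
  apply: (iso_mono (shD_iso (erefl (1 + m)) A)).
  by rewrite !compA shD_nat -(compA _ (shD _ _)) isoKV compm1 -he ay compm0.
have [x hx] := exact_sh (dist_rot1 (dist_rot1 (dist_rot1 uev))) h.
by exists x; rewrite /= hx compA isoKV comp1m.
Qed.

Lemma aug_connecting m x : aug P _ (thV (1 + m) (connecting m x)) = 0.
Proof.
rewrite he Kth /= !compA -(shD_nat (erefl (1 + m)) e).
rewrite -(compA _ (shm m (shm 1 e))) -shmM.
have -> : shm 1 e ∘ w = 0.
  apply/eqP; rewrite -oppr_eq0 -compNm.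
  by rewrite (dist_comp0 (dist_rot1 (dist_rot1 (dist_rot1 uev)))).
by rewrite shm0 compm0 comp0m.
Qed.

Lemma tail_aug_exists : exists aug' : ghom (res P 1) (Mgr (sh 1 X)),
  [/\ forall m x, connecting m (aug' m x) = th _ (bd P 0 m x),
      gsurjective aug' & forall m y, aug' m y = 0 <-> bd P 0 m y = 0].
Proof.
have [|aug' haug'] := ghom_factor (f := ghom_comp (ghom_shift 1 th) (bd P 0))
  connecting_inj.
  move=> m x; apply: connecting_image; apply/aug_exact; by exists x.
exists aug'; split=> // [m c|m y].
  have /aug_exact [x hx] := aug_connecting c.
  exists x; apply/eqP; rewrite -subr_eq0; apply/eqP/connecting_inj.
  by rewrite ghomB haug' /= hx Kth subrr.
split=> h; last first.
  by apply: connecting_inj; rewrite haug' /= h ghom0.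
have := haug' m y; rewrite h ghom0 /= => /esym e0.
by rewrite -[bd P 0 m y]thK e0 ghom0.
Qed.

Lemma connecting_nat (fB : mor B B) (fC : mor (sh 1 X) (sh 1 X)) m x :
  shm 1 fB ∘ w = w ∘ fC ->
  connecting m (shm m fC ∘ x) = shm (1 + m) fB ∘ connecting m x.
Proof.
move=> h; rewrite /= (compA _ (shm m fC)) -shmM -h shmM.
by rewrite !compA shD_nat.
Qed.

End Step.

Lemma is_proj_trace_zero (P : gradedModule R) (Psi : ghom P P) :
  gzero P -> is_proj_trace Psi 0.
Proof.
move=> P0; pose ns (k : 'I_0) : int := 0.
exists (gfree R ns), 0%N, ns, (ghom_zero _ _), (ghom_zero _ _), (ghom_id _).
have Q0 m (y : gfree R ns m) : y = 0 by apply/ffunP => -[].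
split=> [m [x y]|m y|m x y|].
- by rewrite [x]P0 [y]Q0.
- by rewrite [y]Q0.
- by [].
- by rewrite /free_trace big_ord0.
Qed.

(** [n] counts the terms that may be nonzero, so [n = 0] means [M(A) = 0]. Existence of a lift with
    traces belongs to the induction, since the lift of [F] is assembled from one of [fC]. *)
Lemma shift_dualisable_HS_trace n A (P : finite_projective_resolution (Mgr A)) :
  cellular U A -> (forall j, (n <= j)%N -> gzero (res P j)) ->
  shift_dualisable A /\
  forall F : mor A A,
    (exists gs ts, is_lift (P := P) (Mgr_map F) gs /\
       forall j, is_proj_trace (gs j) (ts j)) /\
    (forall gs (ts : nat -> R 0) (D : duality A),
       is_lift (P := P) (Mgr_map F) gs ->
       (forall j, is_proj_trace (gs j) (ts j)) ->
       \sum_(j < n) ts j = to_R0 (trace D F)).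
Proof.
elim: n A P => [|n IH] A P cA P0.
  have MA0 m (x : Mgr A m) : x = 0.
    by have [y <-] := aug_surj P x; rewrite (P0 0%N _ _ y) ?ghom0.
  have zA : is_zero_object A by apply: (cellular_zero cA) => m x; exact: MA0.
  split=> [|F]; first exact: shift_dualisable_zero.
  split=> [|gs ts D _ _].
    exists (fun j => ghom_id _), (fun _ => 0); split.
      by split=> [m x|] //; rewrite [LHS]MA0 [RHS]MA0.
    by move=> j; apply: is_proj_trace_zero; exact: P0.
  have -> : F = 0 by case: (zA A).
  by rewrite big_ord0 trace0 to_R0_0.
have [r [ns [L [i [p [B [j [q [th [thV [ip jq thK Kth]]]]]]]]]]] :=
  realise_projective hcop (res_fg P 0) (@res_proj _ _ P 0%N).
have tB : tame B := tame_retract hcop jq (tame_free hcop ip).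
have [e he'] := tame_full tB (ghom_comp (aug P) thV).
have he m x : aug P m x = shm m e ∘ th m x by rewrite -he' /= thK.
have [X [u [v uev]]] := fibre_exists e.
have [aug' [haug' aug'_surj aug'_ker]] := tail_aug_exists uev thK Kth he.
pose P' := tail_resolution aug'_surj aug'_ker.
have cC : cellular U (sh 1 X).
  exact: (cellular_cone (dist_rot1 uev) (tame_cellular tB) cA).
have [dC IHC] := IH (sh 1 X) P' cC (fun j hj => P0 j.+1 hj).
have dX : shift_dualisable X.
  apply: (shift_dualisable_sim hcop (unsh_sim X (subrr 1))).
  exact: shift_dualisable_sh.
have dA : shift_dualisable A.
  (* Here [A] is the cone of [u]; the traces below use the rotated triangle, which presupposes that
     [A] is dualisable. *)
  exact: (shift_dualisable_cone hcop hadd uev dX (tame_dualisable tB)).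
split=> // F.
(* Any lift of [M(F)] to [P_0] comes from an endomorphism of [B]: fullness provides it, faithfulness
   gives its compatibility with [e]. *)
have real (g0 : ghom (res P 0) (res P 0)) :
    (forall m x, aug P m (g0 m x) = Mgr_map F m (aug P m x)) ->
    exists2 fB : mor B B, F ∘ e = e ∘ fB
      & forall m x, th m (g0 m x) = shm m fB ∘ th m x.
  move=> hg0; have [fB hfB] := tame_full tB (ghom_comp th (ghom_comp g0 thV)).
  exists fB; last by move=> m x; rewrite -hfB /= thK.
  apply: (gHom_faithful_eq (tame_faithful tB)) => m x.
  rewrite !shmM -!compA -hfB /= -he hg0 /= /gHom_fun he.
  by rewrite Kth.
have conn m x : connecting u m (aug' m x) = th _ (bd P 0 m x) := haug' m x.
split=> [|gs ts D [hgs0 hgs] hts].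
  have [g0 hg0] := @res_proj _ _ P 0%N _ _ (aug P)
    (ghom_comp (Mgr_map F) (aug P)) (aug_surj P).
  have [fB eF hfB] := real g0 hg0.
  have [fC [fCv fCw]] := dist_mor (dist_rot1 uev) (dist_rot1 uev) eF.
  have [[gs [ts [[hgs0 hgs] hts]]] _] := IHC fC.
  have [t0 ht0] := proj_trace_exists hcop g0 (res_fg P 0)
    (@res_proj _ _ P 0%N).
  exists (fun j => match j with 0%N => g0 | j'.+1 => gs j' end).
  exists (fun j => match j with 0%N => t0 | j'.+1 => ts j' end).
  split; last by case.
  split=> // -[|k] m x; last exact: hgs.
  rewrite -[LHS]thK -[RHS]thK; congr (thV _ _).
  rewrite hfB -!conn -(connecting_nat _ fCw); congr (connecting u m _).
  exact: hgs0.
have [fB eF hfB] := real (gs 0%N) hgs0.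
have [DB] := shift_dualisable0 hcop (tame_dualisable tB).
have [DC [fC [fCv fCw trE]]] := hadd DB D (dist_rot1 uev) eF.
have [_ IHt] := IHC fC.
(* Whichever [fC] additivity returns, the tail of [gs] lifts [M(fC)]: both sides agree after the
   injective map [connecting]. *)
have sumC : \sum_(j < n) ts j.+1 = to_R0 (trace DC fC).
  apply: (IHt (fun j => gs j.+1) (fun j => ts j.+1)) => [|k]; last exact: hts.
  split=> [m x|k m x]; last exact: hgs.
  apply/eqP; rewrite -subr_eq0; apply/eqP.
  apply: (connecting_inj uev he); rewrite ghomB.
  rewrite [connecting u m (aug P' m _)]conn hgs hfB -conn.
  by rewrite -(connecting_nat _ fCw) subrr.
rewrite big_ord_recl /= sumC.
rewrite (realised_trace hcop hadd DB tB thK Kth hfB (hts 0%N)).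
rewrite -to_R0D; congr to_R0; apply/eqP.
by move/eqP: trE; rewrite addrAC subr_eq0 addrC.
Qed.

End Main.

Theorem theorem4p2 (T : tensorTriangulated)
    (hcoprod : has_countable_coproducts T)
    (hadd : additivity_of_traces T)
    (A : T) (F : mor A A)
    (hA : in_localising_generated_by tt1 A)
    (hres : inhabited (finite_projective_resolution (Mgr A))) :
  dualisable A /\
  forall (D : duality A) (t : Rgr T 0%R),
    is_HS_trace (Mgr_map F) t <-> t = to_R0 (trace D F).
Proof.
have main (P : finite_projective_resolution (Mgr A)) :=
  shift_dualisable_HS_trace hcoprod hadd (localising_cellular hA)
    (fun j (hj : ((res_len P).+1 <= j)%N) => res_finite hj).
have [P] := hres; have [dA hF] := main P.
split=> [|D t]; first exact: (shift_dualisable0 hcoprod dA).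
split=> [[P' [gs [ts [hgs hts ->]]]]|->].
  (* The given trace may come from another resolution [P'], for which the induction yields the same
     value. *)
  by have [_ hF'] := main P'; have [_ htr] := hF' F; exact: (htr gs ts D).
have [[gs [ts [hgs hts]]] htr] := hF F.
by exists P, gs, ts; split=> //; rewrite (htr gs ts D).
Qed.
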